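(* Let $E\to M$ be a transitive Courant algebroid and $L\subset E_{\mathbb C}$ a generalized complex structure on $E$. Then the Lie algebroid complex $(\Gamma(\Lambda^\bullet L^* ),d_L)$ is elliptic.
   Context: A Courant algebroid on $M$ is a real vector bundle $E\to M$ with a non-degenerate symmetric bilinear form $\langle\cdot,\cdot\rangle$, a bilinear bracket $[\cdot,\cdot]$ on $\Gamma(E)$ (Dorfman bracket) and a vector bundle map $\pi\colon E\to TM$ (anchor) such that for all $u,v,w\in\Gamma(E)$: $[u,[v,w]]=[[u,v],w]+[v,[u,w]]$; $\pi(u)\langle v,w\rangle=\langle[u,v],w\rangle+\langle v,[u,w]\rangle$; $\langle[u,v]+[v,u],w\rangle=\pi(w)\langle u,v\rangle$. It is transitive if $\pi$ is surjective. A generalized complex structure on $E$ is a maximally isotropic subbundle $L\subset E_{\mathbb C}$ with $E_{\mathbb C}=L\oplus\bar L$ such that $\Gamma(L)$ is closed under the ($\mathbb C$-bilinearly extended) Dorfman bracket. Then $L$ with the restricted bracket and (complexified) anchor is a complex Lie algebroid, with differential $d_L\colon\Gamma(\Lambda^kL^* )\to\Gamma(\Lambda^{k+1}L^* )$, $$(d_L\varphi)(u_0,\dots,u_k)=\sum_i(-1)^i\pi(u_i)\varphi(u_0,\dots,\hat u_i,\dots,u_k)+\sum_{i<j}(-1)^{i+j}\varphi([u_i,u_j],u_0,\dots,\hat u_i,\dots,\hat u_j,\dots,u_k),$$ a first order differential operator with $d_L^2=0$. The complex is elliptic if its principal symbol sequence is exact for every nonzero real covector $\alpha\in T^*M$.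 *)

(* Defs.v *)
From HB Require Import structures.
From mathcomp Require Import all_boot all_order all_algebra.
From mathcomp Require Import all_classical all_reals all_analysis.
From mathcomp Require Import complex.

Set Implicit Arguments.
Unset Strict Implicit.
Unset Printing Implicit Defensive.
Import Order.TTheory GRing.Theory Num.Theory.
Import numFieldNormedType.Exports.
Local Open Scope classical_set_scope.
Local Open Scope complex_scope.
Local Open Scope ring_scope.

Definition is_basis (K : nzRingType) (V : lmodType K) (n : nat)
    (e : 'I_n -> V) : Prop :=
  forall v : V, exists! a : 'I_n -> K, v = \sum_(i < n) a i *: e i.

Section Subspace.
Variables (K : nzRingType) (V : lmodType K) (S : submodClosed V).

Definition subspace : Type := {v : V | v \in S}.

HB.instance Definition _ := SubChoice.on subspace.
HB.instance Definition _ := [SubChoice_isSubLmodule of subspace by <:].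

End Subspace.

(* The complexification V + iV: the pair (a, b) stands for a + ib. *)
Definition cplx (R : rcfType) (V : lmodType R) : Type := (V * V)%type.

Section Complexification.
Variables (R : rcfType) (V : lmodType R).

HB.instance Definition _ := GRing.Zmodule.on (cplx V).

Definition cplx_scale (z : R[i]) (v : cplx V) : cplx V :=
  (complex.Re z *: v.1 - complex.Im z *: v.2,
   complex.Re z *: v.2 + complex.Im z *: v.1).

Fact cplx_scaleA a b v : cplx_scale a (cplx_scale b v) = cplx_scale (a * b) v.
Proof.
case: a b v => [a1 a2] [b1 b2] [v1 v2].
rewrite /cplx_scale /=; congr (_, _).
  rewrite !scalerBr !scalerDr scalerBl scalerDl !scalerA !opprD -!addrA.
  by congr (_ + _); rewrite addrC -!addrA addrC -!addrA.
rewrite scalerDr scalerBr scalerBl scalerDl !scalerA -!addrA.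
by congr (_ + _); rewrite addrA addrC.
Qed.

Fact cplx_scale1 : left_id 1 cplx_scale.
Proof. by case=> a b; rewrite /cplx_scale /= !scale1r !scale0r subr0 addr0. Qed.

Fact cplx_scaleDr : right_distributive cplx_scale +%R.
Proof.
by move=> z [a b] [c d]; congr (_, _); rewrite /= !scalerDr ?opprD addrACA.
Qed.

Fact cplx_scaleDl v : {morph cplx_scale^~ v : a b / a + b}.
Proof.
by case: v => [c d] [a1 a2] [b1 b2]; congr (_, _);
  rewrite /= !scalerDl ?opprD addrACA.
Qed.

HB.instance Definition _ := GRing.Zmodule_isLmodule.Build R[i] (cplx V)
  cplx_scaleA cplx_scale1 cplx_scaleDr cplx_scaleDl.

Definition cconj (v : cplx V) : cplx V := (v.1, - v.2).

End Complexification.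

(* The k-th exterior power of the dual of V, as alternating k-linear forms. *)
Section AlternatingForms.
Variables (K : comNzRingType) (V : lmodType K) (k : nat).

Definition multilinear (phi : ('I_k -> V) -> K) : Prop :=
  forall (i : 'I_k) (v : 'I_k -> V) (a : K) (x y : V),
    phi [eta v with i |-> a *: x + y] =
    a * phi [eta v with i |-> x] + phi [eta v with i |-> y].

Definition alternating (phi : ('I_k -> V) -> K) : Prop :=
  forall (v : 'I_k -> V) (i j : 'I_k), i != j -> v i = v j -> phi v = 0.

Definition alt_pred : {pred ('I_k -> V) -> K^o} :=
  [pred phi | `[< multilinear phi /\ alternating phi >]].

Fact alt_pred_submod_closed : submod_closed alt_pred.
Proof.
split=> [|a f g /asboolP[mf af] /asboolP[mg ag]]; apply/asboolP; split.
- by move=> *; rewrite /= mulr0 addr0.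
- by [].
- move=> i v b x y; have E w : (a *: f + g) w = a * f w + g w by [].
  by rewrite !E mf mg !mulrDr !mulrA (mulrC a b) addrACA.
- move=> v i j ij vij; have -> : (a *: f + g) v = a * f v + g v by [].
  by rewrite (af v i j) // (ag v i j) // mulr0 addr0.
Qed.

HB.instance Definition _ := GRing.isSubmodClosed.Build K (('I_k -> V) -> K^o)
  alt_pred alt_pred_submod_closed.

Definition alt_form : Type := {phi : ('I_k -> V) -> K^o | phi \in alt_pred}.

HB.instance Definition _ := SubChoice.on alt_form.
HB.instance Definition _ := [SubChoice_isSubLmodule of alt_form by <:].

Definition alt_eval (phi : alt_form) (v : 'I_k -> V) : K := \val phi v.

End AlternatingForms.

Fixpoint Ck (R : realType) (m k : nat) (U : set 'rV[R]_m) (f : 'rV[R]_m -> R)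
    : Prop :=
  if k is k'.+1 then
    (forall x, U x -> differentiable f x) /\
    forall i : 'I_m, Ck k' U ('D_(delta_mx 0 i) f)
  else forall x, U x -> {for x, continuous f}.

Definition Cinfty (R : realType) (m : nat) (U : set 'rV[R]_m)
    (f : 'rV[R]_m -> R) : Prop := forall k, Ck k U f.

Record chart (R : realType) (m : nat) (M : topologicalType) := Chart {
  chart_dom : set M;
  chart_cod : set 'rV[R]_m;
  chart_map : M -> 'rV[R]_m;
  chart_inv : 'rV[R]_m -> M;
  chart_dom_open : open chart_dom;
  chart_cod_open : open chart_cod;
  chart_map_cod : forall x, chart_dom x -> chart_cod (chart_map x);
  chart_inv_dom : forall y, chart_cod y -> chart_dom (chart_inv y);
  chart_mapK : forall x, chart_dom x -> chart_inv (chart_map x) = x;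
  chart_invK : forall y, chart_cod y -> chart_map (chart_inv y) = y;
  chart_map_continuous :
    forall x, chart_dom x -> {for x, continuous chart_map};
  chart_inv_continuous :
    forall y, chart_cod y -> {for y, continuous chart_inv} }.

(* The atlas need not be maximal: it determines the smooth structure. *)
Record smoothManifold (R : realType) (m : nat) := SmoothManifold {
  mfd_space :> topologicalType;
  mfd_hausdorff : hausdorff_space mfd_space;
  mfd_second_countable : @second_countable mfd_space;
  atlas : set (chart R m mfd_space);
  atlas_cover : forall x, exists2 c, atlas c & chart_dom c x;
  atlas_compat : forall c c', atlas c -> atlas c' -> forall i : 'I_m,
    Cinfty (chart_cod c `&` chart_inv c @^-1` chart_dom c')
           (fun y => chart_map c' (chart_inv c y) 0 i) }.

Section Smooth.
Variables (R : realType) (m : nat) (M : smoothManifold R m).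

Definition smooth_on (U : set M) (f : M -> R) : Prop :=
  forall c, atlas c ->
    Cinfty (chart_cod c `&` chart_inv c @^-1` U) (f \o chart_inv c).

Definition smooth (f : M -> R) : Prop := smooth_on setT f.

Definition csmooth_on (U : set M) (f : M -> R[i]) : Prop :=
  smooth_on U (fun x => complex.Re (f x)) /\
  smooth_on U (fun x => complex.Im (f x)).

(* The tangent space at x consists of the derivations at x of the algebra of
   smooth functions on M.  A derivation is extended by 0 to the functions that
   are not smooth, so that it is determined by its values on the smooth ones. *)
Definition derivation_at (x : M) (D : (M -> R) -> R) : Prop :=
  [/\ forall f, ~ smooth f -> D f = 0,
      forall (a : R) f g, smooth f -> smooth g ->
        D (fun y => a * f y + g y) = a * D f + D g
    & forall f g, smooth f -> smooth g ->
        D (fun y => f y * g y) = f x * D g + g x * D f].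

Section Tangent.
Variable x : M.

Definition tangent_pred : {pred (M -> R) -> R^o} :=
  [pred D | `[< derivation_at x D >]].

Fact tangent_pred_submod_closed : submod_closed tangent_pred.
Proof.
split=> [|a D D' /asboolP[D0 Dl Dm] /asboolP[D'0 D'l D'm]].
  by apply/asboolP; split=> // *; rewrite /= !mulr0 addr0.
have E f : (a *: D + D') f = a * D f + D' f by [].
apply/asboolP; split.
- by move=> f nf; rewrite E D0 // D'0 // mulr0 addr0.
- move=> b f g sf sg; rewrite !E Dl // D'l //.
  by rewrite !mulrDr !mulrA (mulrC a b) addrACA.
- move=> f g sf sg; rewrite !E Dm // D'm //.
  by rewrite !mulrDr !mulrA !(mulrC a) addrACA.
Qed.

HB.instance Definition _ := GRing.isSubmodClosed.Build R ((M -> R) -> R^o)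
  tangent_pred tangent_pred_submod_closed.

Definition tangent : Type := {D : (M -> R) -> R^o | D \in tangent_pred}.

HB.instance Definition _ := SubChoice.on tangent.
HB.instance Definition _ := [SubChoice_isSubLmodule of tangent by <:].

Definition der (X : tangent) (f : M -> R) : R := \val X f.

Definition covector : Type := {linear tangent -> R^o}.

Definition differential (f : M -> R) (X : tangent) : R^o := der X f.

Fact differential_is_linear f : linear (differential f).
Proof. by []. Qed.

HB.instance Definition _ f := GRing.isLinear.Build R tangent R^o *:%R
  (differential f) (differential_is_linear f).

End Tangent.

Section Frames.
Variable E : M -> lmodType R.

Record local_frame := LocalFrame {
  frame_dom : set M;
  frame_rank : nat;
  frame_vec : 'I_frame_rank -> forall x, E x }.

Definition smooth_in_frame (e : local_frame) (U : set M) (s : forall x, E x)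
    : Prop :=
  exists a : 'I_(frame_rank e) -> M -> R,
    (forall i, smooth_on (U `&` frame_dom e) (a i)) /\
    forall x, (U `&` frame_dom e) x ->
      s x = \sum_(i < frame_rank e) a i x *: frame_vec i x.

End Frames.

(* A vector bundle is given by its fibres and a compatible family of local
   frames; its rank is locally constant. *)
Record vbundle := VBundle {
  fiber :> M -> lmodType R;
  frames : set (local_frame fiber);
  frames_open : forall e, frames e -> open (frame_dom e);
  frames_cover : forall x, exists2 e, frames e & frame_dom e x;
  frames_basis : forall e, frames e -> forall x, frame_dom e x ->
    is_basis (fun i => frame_vec (l := e) i x);
  frames_compat : forall e e', frames e -> frames e' ->
    forall j, smooth_in_frame e (frame_dom e') (frame_vec (l := e') j) }.

Section Sections.
Variable E : vbundle.

Definition smooth_section_on (U : set M) (s : forall x, E x) : Prop :=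
  forall e, frames e -> smooth_in_frame e U s.

Definition smooth_section (s : forall x, E x) : Prop :=
  smooth_section_on setT s.

Definition csmooth_section_on (U : set M) (s : forall x, cplx (E x)) : Prop :=
  smooth_section_on U (fun x => (s x).1) /\
  smooth_section_on U (fun x => (s x).2).

Definition csmooth_section (s : forall x, cplx (E x)) : Prop :=
  csmooth_section_on setT s.

End Sections.

Section Elliptic.
Variables (F : nat -> M -> lmodType R[i]).
Variable (Gamma : forall k, set (forall x, F k x)).
Variable (P : forall k, (forall x, F k x) -> forall x, F k.+1 x).

(* The symbol of a first order operator P is characterized by
   sigma(df) s = P(f s) - f P(s); it is unique as soon as every point of F k is
   the value of a section in Gamma k, because every covector is some df. *)
Definition is_principal_symbol
    (sigma : forall k x, covector x -> {linear F k x -> F k.+1 x}) : Prop :=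
  forall k (f : M -> R) (s : forall x, F k x), smooth f -> Gamma s ->
  forall x, P (fun y => (f y)%:C *: s y) x - (f x)%:C *: P s x
            = sigma k x (differential f : covector x) (s x).

(* Exactness of 0 -> F 0 x -> F 1 x -> ... *)
Definition symbol_exact
    (sigma : forall k x, covector x -> {linear F k x -> F k.+1 x}) : Prop :=
  forall x (alpha : covector x), ~ (forall X, alpha X = 0) ->
    (forall e, sigma 0%N x alpha e = 0 -> e = 0) /\
    forall k (e : F k.+1 x),
      sigma k.+1 x alpha e = 0 <-> exists e', e = sigma k x alpha e'.

Definition elliptic_complex : Prop :=
  exists sigma, is_principal_symbol sigma /\ symbol_exact sigma.

End Elliptic.

(* The bracket is only meaningful on smooth sections. *)
Record courantAlgebroid := CourantAlgebroid {
  ca_bundle :> vbundle;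
  pairing : forall x, ca_bundle x -> ca_bundle x -> R;
  bracket : (forall x, ca_bundle x) -> (forall x, ca_bundle x) ->
            forall x, ca_bundle x;
  anchor : forall x, {linear ca_bundle x -> tangent x};
  pairing_sym : forall x (u v : ca_bundle x), pairing u v = pairing v u;
  pairing_linear : forall x (a : R) (u v w : ca_bundle x),
    pairing (a *: u + v) w = a * pairing u w + pairing v w;
  pairing_nondegenerate : forall x (u : ca_bundle x),
    (forall v, pairing u v = 0) -> u = 0;
  pairing_smooth : forall (U : set M) (u v : forall x, ca_bundle x), open U ->
    smooth_section_on U u -> smooth_section_on U v ->
    smooth_on U (fun x => pairing (u x) (v x));
  anchor_smooth : forall (U : set M) (u : forall x, ca_bundle x) (f : M -> R),
    open U -> smooth_section_on U u -> smooth f ->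
    smooth_on U (fun x => der (anchor x (u x)) f);
  bracket_smooth : forall u v, smooth_section u -> smooth_section v ->
    smooth_section (bracket u v);
  bracket_linear_l : forall (a : R) u v w,
    smooth_section u -> smooth_section v -> smooth_section w ->
    forall x, bracket (fun y => a *: u y + v y) w x
              = a *: bracket u w x + bracket v w x;
  bracket_linear_r : forall (a : R) u v w,
    smooth_section u -> smooth_section v -> smooth_section w ->
    forall x, bracket u (fun y => a *: v y + w y) x
              = a *: bracket u v x + bracket u w x;
  bracket_jacobi : forall u v w,
    smooth_section u -> smooth_section v -> smooth_section w ->
    forall x, bracket u (bracket v w) x
              = bracket (bracket u v) w x + bracket v (bracket u w) x;
  bracket_pairing : forall u v w,
    smooth_section u -> smooth_section v -> smooth_section w ->
    forall x, der (anchor x (u x)) (fun y => pairing (v y) (w y))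
              = pairing (bracket u v x) (w x) + pairing (v x) (bracket u w x);
  bracket_sym : forall u v w,
    smooth_section u -> smooth_section v -> smooth_section w ->
    forall x, pairing (bracket u v x + bracket v u x) (w x)
              = der (anchor x (w x)) (fun y => pairing (u y) (v y)) }.

Definition transitive_ca (E : courantAlgebroid) : Prop :=
  forall x (X : tangent x), exists u : E x, anchor E x u = X.

Section ComplexExtension.
Variable E : courantAlgebroid.

Definition cpairing x (u v : cplx (E x)) : R[i] :=
  (pairing u.1 v.1 - pairing u.2 v.2) +i* (pairing u.1 v.2 + pairing u.2 v.1).

Definition cbracket (u v : forall x, cplx (E x)) (x : M) : cplx (E x) :=
  let u1 y := (u y).1 in let u2 y := (u y).2 in
  let v1 y := (v y).1 in let v2 y := (v y).2 in
  (bracket u1 v1 x - bracket u2 v2 x, bracket u1 v2 x + bracket u2 v1 x).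

Definition cder x (u : cplx (E x)) (g : M -> R[i]) : R[i] :=
  let X1 := anchor E x u.1 in let X2 := anchor E x u.2 in
  let g1 y := complex.Re (g y) in let g2 y := complex.Im (g y) in
  (der X1 g1 - der X2 g2) +i* (der X1 g2 + der X2 g1).

Definition isotropic x (S : {pred cplx (E x)}) : Prop :=
  {in S &, forall u v, cpairing u v = 0}.

Record generalizedComplex := GeneralizedComplex {
  gcs :> forall x, submodClosed (cplx (E x));
  gcs_subbundle : forall x, exists (U : set M) (r : nat)
      (l : 'I_r -> forall y, subspace (gcs y)),
    [/\ open U, U x,
        forall i, csmooth_section_on U (fun y => \val (l i y))
      & forall y, U y -> is_basis (fun i => l i y)];
  gcs_isotropic : forall x, isotropic (gcs x);
  gcs_maximal : forall x (S : submodClosed (cplx (E x))),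
    isotropic S -> {subset gcs x <= S} -> {subset S <= gcs x};
  gcs_decomposition : forall x (w : cplx (E x)),
    exists! p : cplx (E x) * cplx (E x),
      [/\ p.1 \in gcs x, cconj p.2 \in gcs x & w = p.1 + p.2];
  gcs_involutive : forall u v : forall x, cplx (E x),
    csmooth_section u -> csmooth_section v ->
    (forall x, u x \in gcs x) -> (forall x, v x \in gcs x) ->
    forall x, cbracket u v x \in gcs x }.

Section Differential.
Variable L : generalizedComplex.

Definition lsection : Type := forall x, subspace (L x).

Definition lsmooth_on (U : set M) (u : lsection) : Prop :=
  csmooth_section_on U (fun x => \val (u x)).

(* For smooth u and v, cbracket u v x is in L x and the default is not used. *)
Definition lbracket (u v : lsection) : lsection :=
  fun x => insubd 0 (cbracket (fun y => \val (u y)) (fun y => \val (v y)) x).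

Definition lform (k : nat) (x : M) : lmodType R[i] :=
  alt_form (subspace (L x)) k.

Definition lform_eval k x (phi : lform k x) (v : 'I_k -> subspace (L x))
    : R[i] := alt_eval phi v.


Definition smooth_lform (k : nat) (phi : forall x, lform k x) : Prop :=
  forall (U : set M) (u : 'I_k -> lsection), open U ->
    (forall i, lsmooth_on U (u i)) ->
    csmooth_on U (fun x => lform_eval (phi x) (fun i => u i x)).

Definition cons_sections (k : nat) (w : lsection) (u : 'I_k -> lsection)
    (i : 'I_k.+1) : lsection :=
  if unlift ord0 i is Some j then u j else w.

(* (d_L phi)(u_0, ..., u_k).  In the second sum the pair i < i' of the usual
   formula is indexed by i and j with i' = lift i j; omitting both u_i and u_i'
   leaves the sections u (lift i (lift j p)), p < k. *)
Definition koszul_anchor (k : nat) (phi : forall x, lform k x)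
    (u : 'I_k.+1 -> lsection) (x : M) : R[i] :=
  \sum_(i < k.+1) (-1) ^+ i *
    cder (\val (u i x)) (fun y => lform_eval (phi y) (fun p => u (lift i p) y)).

Definition koszul_bracket (k : nat)
    : (forall x, lform k x) -> ('I_k.+1 -> lsection) -> M -> R[i] :=
  match k with
  | 0 => fun _ _ _ => 0
  | k'.+1 => fun phi u x =>
      \sum_(i < k'.+2) \sum_(j < k'.+1 | (i < lift i j)%N)
        (-1) ^+ (i + lift i j) *
        lform_eval (phi x)
          (fun q => cons_sections (lbracket (u i) (u (lift i j)))
                      (fun p : 'I_k' => u (lift i (lift j p))) q x)
  end.

Definition koszul (k : nat) (phi : forall x, lform k x)
    (u : 'I_k.+1 -> lsection) (x : M) : R[i] :=
  koszul_anchor phi u x + koszul_bracket phi u x.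

(* (d_L phi)_x is the alternating form whose value at (u_0(x), ..., u_k(x)) is
   given by the formula above, for all smooth sections u_0, ..., u_k of L. *)
Definition dL (k : nat) (phi : forall x, lform k x) (x : M) : lform k.+1 x :=
  xget 0 [set psi : lform k.+1 x | forall u : 'I_k.+1 -> lsection,
    (forall i, lsmooth_on setT (u i)) ->
    lform_eval psi (fun i => u i x) = koszul phi u x].

End Differential.
End ComplexExtension.
End Smooth.

(* Main.v *)
Require Import Defs.
From HB Require Import structures.
From mathcomp Require Import all_boot all_order all_algebra all_fingroup.
From mathcomp Require Import all_classical all_reals all_analysis.
From mathcomp Require Import complex ring.

(* The principal symbol at a covector alpha is the exterior product with the
   restriction xi of alpha o pi to L.  If xi vanished, then alpha o pi, being
   real, would vanish on the conjugate of L too, hence on all of E; by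
   transitivity alpha would be 0.  So xi e = 1 for some e in L when alpha is
   nonzero, and contraction with e is then a contracting homotopy of the symbol
   sequence.

   The definition of d_L through a choice operator is only meaningful because
   the Koszul formula is tensorial.  Over the ring of smooth complex functions,
   the sections of L form a Lie-Rinehart pair: on L the bracket is alternating
   by isotropy, and its Leibniz rule follows from the invariance and the
   nondegeneracy of the pairing.  Cartan's formula shows by induction that the
   Koszul formula is then alternating and multilinear over smooth functions, and
   bump functions turn this multilinearity into dependence on the values at a
   point. *)

Set Implicit Arguments.
Unset Strict Implicit.
Unset Printing Implicit Defensive.
Import Order.TTheory GRing.Theory Num.Theory.
Import numFieldNormedType.Exports.
Import Defs.
Local Open Scope classical_set_scope.
Local Open Scope complex_scope.
Local Open Scope ring_scope.

(** * Alternating forms *)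

Section Tuples.
Variables (T : Type) (k : nat).

(** Two obstacles shape the proof. The bracket is only given on global sections, so the Koszul
    formula cannot be computed in a local frame; frames are cut off by bump functions instead.
    Moreover the smoothness of a section of L is measured in frames of E, so its coefficients in a
    frame of L are not smooth by definition. Since [E_C] is the sum of L and its conjugate and L is
    isotropic, L pairs nondegenerately with its conjugate; pairings with the conjugate frame are
    smooth and determine these coefficients by Cramer's rule. All sign computations are inductions
    on the number of arguments that split off the first one, hence the tuples [fcons w u]:
    contraction with [w] lowers the degree by one, and double sums never have to be rearranged
    globally. One identity serves twice: the failure of the formula to be linear over functions in
    the form is the exterior product with [df], which is needed for linearity in the sections and is
    also the symbol. *)

Definition fcons (w : T) (u : 'I_k -> T) (i : 'I_k.+1) : T :=
  if unlift ord0 i is Some j then u j else w.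

Definition upd (u : 'I_k -> T) (i : 'I_k) (a : T) : 'I_k -> T :=
  fun j => if j == i then a else u j.

Lemma updE u i a : ([eta u with i |-> a] : _ -> _) = upd u i a.
Proof. by []. Qed.

Lemma fcons0 w u : fcons w u ord0 = w.
Proof. by rewrite /fcons unlift_none. Qed.

Lemma fconsS w u j : fcons w u (lift ord0 j) = u j.
Proof. by rewrite /fcons liftK. Qed.

Lemma fcons_eta (v : 'I_k.+1 -> T) : v = fcons (v ord0) (v \o lift ord0).
Proof.
apply/funext=> i; case: (unliftP ord0 i) => [j ->|->].
  by rewrite fconsS.
by rewrite fcons0.
Qed.

Lemma fcons_tail w u : fcons w u \o lift ord0 = u.
Proof. by apply/funext => j /=; rewrite fconsS. Qed.

Lemma upd_eq u i a : upd u i a i = a.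
Proof. by rewrite /upd eqxx. Qed.

Lemma upd_neq u i a j : j != i -> upd u i a j = u j.
Proof. by rewrite /upd => /negbTE ->. Qed.

Lemma upd_id u i : upd u i (u i) = u.
Proof. by apply/funext=> j; rewrite /upd; case: eqP => // ->. Qed.

Lemma upd_upd u i a b : upd (upd u i a) i b = upd u i b.
Proof. by apply/funext=> j; rewrite /upd; case: eqP. Qed.

Lemma upd_swap u i j a b : i != j ->
  upd (upd u i a) j b = upd (upd u j b) i a.
Proof.
move=> ij; apply/funext=> l; rewrite /upd; case: (eqVneq l j) => // ->.
by rewrite eq_sym (negbTE ij).
Qed.

End Tuples.

Lemma upd_cons0 T k (w : T) (u : 'I_k -> T) a :
  upd (fcons w u) ord0 a = fcons a u.
Proof.
apply/funext=> i; case: (unliftP ord0 i) => [j ->|->].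
  by rewrite fconsS upd_neq // fconsS.
by rewrite upd_eq fcons0.
Qed.

Lemma upd_consS T k (w : T) (u : 'I_k -> T) i a :
  upd (fcons w u) (lift ord0 i) a = fcons w (upd u i a).
Proof.
apply/funext=> l; case: (unliftP ord0 l) => [j ->|->].
  by rewrite fconsS /upd (inj_eq (@lift_inj _ _)) fconsS.
by rewrite upd_neq ?neq_lift // !fcons0.
Qed.

Lemma fcons_lift T k (w : T) (u : 'I_k.+1 -> T) (i : 'I_k.+1) :
  fcons w u \o lift (lift ord0 i) = fcons w (u \o lift i).
Proof.
apply/funext=> l /=; case: (unliftP ord0 l) => [j ->|->].
  rewrite fconsS /=.
  have -> : lift (lift ord0 i) (lift ord0 j) = lift ord0 (lift i j).
    by apply/val_inj; rewrite /= !bumpS.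
  by rewrite fconsS.
have -> : lift (lift ord0 i) ord0 = ord0 :> 'I_k.+2 by apply/val_inj.
by rewrite !fcons0.
Qed.

Section AltTheory.
Variables (K : comNzRingType) (V : lmodType K).
Implicit Type k : nat.

Lemma alt_form_multilinear k (p : alt_form V k) : multilinear (alt_eval p).
Proof. by have /asboolP[] := valP p. Qed.

Lemma alt_form_alternating k (p : alt_form V k) : alternating (alt_eval p).
Proof. by have /asboolP[] := valP p. Qed.

Definition mk_alt k (f : ('I_k -> V) -> K) (mf : multilinear f)
  (af : alternating f) : alt_form V k :=
  exist _ (f : ('I_k -> V) -> K^o) (introT (asboolP _) (conj mf af)).

Lemma alt_form_ext k (p q : alt_form V k) :
  (forall v, alt_eval p v = alt_eval q v) -> p = q.
Proof. by move=> pq; apply/val_inj/funext. Qed.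

Lemma alt_evalD k (p q : alt_form V k) v :
  alt_eval (p + q) v = alt_eval p v + alt_eval q v.
Proof. by []. Qed.

Lemma alt_evalZ k a (p : alt_form V k) v :
  alt_eval (a *: p) v = a * alt_eval p v.
Proof. by []. Qed.

Lemma alt_eval0 k v : alt_eval (0 : alt_form V k) v = 0.
Proof. by []. Qed.

Section Multilinear.
Variables (k : nat) (f : ('I_k -> V) -> K).
Hypotheses (mf : multilinear f) (af : alternating f).

Lemma multilinearP i v a x y :
  f (upd v i (a *: x + y)) = a * f (upd v i x) + f (upd v i y).
Proof. exact: mf. Qed.

Lemma multilinearD i v x y : f (upd v i (x + y)) = f (upd v i x) + f (upd v i y).
Proof. by rewrite -[x]scale1r multilinearP mul1r scale1r. Qed.

Lemma multilinear0 i v : f (upd v i 0) = 0.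
Proof.
have := multilinearD i v 0 0; rewrite addr0 => /eqP.
by rewrite -subr_eq subrr eq_sym => /eqP.
Qed.

Lemma multilinearN i v x : f (upd v i (- x)) = - f (upd v i x).
Proof. by apply/eqP; rewrite -addr_eq0 -multilinearD addNr multilinear0. Qed.

(** Polarization: expand the vanishing value at [x + y] in both slots. *)
Lemma alt_upd2 v i j x y : i != j ->
  f (upd (upd v i x) j y) = - f (upd (upd v i y) j x).
Proof.
move=> ij; have E z : f (upd (upd v i z) j z) = 0.
  by apply: (af ij); rewrite upd_eq upd_neq // upd_eq.
have := E (x + y); rewrite multilinearD ![upd (upd v i (x + y)) j _]upd_swap //.
rewrite !multilinearD -![upd (upd v j _) i _]upd_swap // !E add0r addr0 addrC.
by move/eqP; rewrite addr_eq0 => /eqP.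
Qed.

Lemma alt_tperm v i j : i != j -> f (v \o tperm i j) = - f v.
Proof.
move=> ij; have -> : v \o tperm i j = upd (upd v i (v j)) j (v i).
  apply/funext=> l; rewrite /upd /=.
  by case: tpermP => [->|->|/eqP/negbTE-> /eqP/negbTE->];
    rewrite ?eqxx // (negbTE ij).
by rewrite alt_upd2 // !upd_id.
Qed.

Lemma alt_perm v (s : 'S_k) : f (v \o s) = (-1) ^+ s * f v.
Proof.
have [ts -> dts] := prod_tpermP s.
elim: ts v dts => [|t ts IH] v /=.
  move=> _; rewrite big_nil odd_perm1 mul1r; congr f.
  by apply/funext=> i /=; rewrite perm1.
case/andP=> dt dts; rewrite big_cons odd_mul_tperm dt.
have -> : v \o (tperm t.1 t.2 * \prod_(j <- ts) tperm j.1 j.2)%g =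
   (v \o (\prod_(j <- ts) tperm j.1 j.2)%g) \o tperm t.1 t.2.
  by apply/funext=> i /=; rewrite permM.
by rewrite alt_tperm // IH // signr_addb !mulNr mul1r.
Qed.

End Multilinear.

Lemma alt_fcons_swap k (f : ('I_k.+2 -> V) -> K) (mf : multilinear f)
    (af : alternating f) x y v :
  f (fcons x (fcons y v)) = - f (fcons y (fcons x v)).
Proof.
have E a b : fcons a (fcons b v) =
    upd (upd (fcons x (fcons y v)) ord0 a) (lift ord0 ord0) b.
  by rewrite upd_cons0 upd_consS upd_cons0.
by rewrite [in LHS]E [in RHS]E (alt_upd2 mf af).
Qed.

Lemma alt_move k (f : ('I_k.+1 -> V) -> K) (mf : multilinear f)
    (af : alternating f) (v : 'I_k.+1 -> V) (j : 'I_k.+1) w :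
  f (fcons w (v \o lift j)) = (-1) ^+ j * f (upd v j w).
Proof.
(* The cycle [lift_perm ord0 j 1] sends [ord0] to [j] and [lift ord0 l] to [lift j l]; its sign is
   [(-1) ^+ j]. *)
have -> : fcons w (v \o lift j) = upd v j w \o lift_perm ord0 j 1%g.
  apply/funext=> i /=; case: (unliftP ord0 i) => [l ->|->].
    by rewrite fconsS lift_perm_lift perm1 upd_neq // eq_sym neq_lift.
  by rewrite fcons0 lift_perm_id upd_eq.
by rewrite (alt_perm mf af) odd_lift_perm odd_perm1 addbF /= signr_odd.
Qed.

Lemma multilinear_fcons k (f : ('I_k.+1 -> V) -> K) w :
  multilinear f -> multilinear (f \o fcons w).
Proof.
by move=> mf i v a x y; rewrite /= !updE -!upd_consS multilinearP.
Qed.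

Lemma alternating_fcons k (f : ('I_k.+1 -> V) -> K) w :
  alternating f -> alternating (f \o fcons w).
Proof.
move=> af v i j ij vij /=; apply: (af _ (lift ord0 i) (lift ord0 j)).
  by rewrite (inj_eq lift_inj).
by rewrite !fconsS.
Qed.

Definition contract k (w : V) (p : alt_form V k.+1) : alt_form V k :=
  mk_alt (@multilinear_fcons _ _ w (@alt_form_multilinear _ p))
         (@alternating_fcons _ _ w (@alt_form_alternating _ p)).

Lemma contractE k w (p : alt_form V k.+1) v :
  alt_eval (contract w p) v = alt_eval p (fcons w v).
Proof. by []. Qed.

Lemma contract_linear_vec k a w w' (p : alt_form V k.+1) :
  contract (a *: w + w') p = a *: contract w p + contract w' p.
Proof.
apply: alt_form_ext => v; rewrite alt_evalD alt_evalZ !contractE.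
rewrite -(upd_cons0 0 v) (multilinearP (@alt_form_multilinear _ p)).
by rewrite !upd_cons0.
Qed.

Lemma contract_contract k w (p : alt_form V k.+2) :
  contract w (contract w p) = 0.
Proof.
apply: alt_form_ext => v; rewrite !contractE alt_eval0.
by apply: (@alt_form_alternating _ p _ ord0 (lift ord0 ord0));
  rewrite // fcons0 fconsS fcons0.
Qed.

Lemma alt_multilinear_cons k (f : ('I_k.+1 -> V) -> K) :
    (forall u a w w',
      f (fcons (a *: w + w') u) = a * f (fcons w u) + f (fcons w' u)) ->
    (forall w, multilinear (f \o fcons w)) -> multilinear f.
Proof.
move=> f0 fS i v a x y; rewrite !updE (fcons_eta v).
case: (unliftP ord0 i) => [j ->|->].
  by rewrite !upd_consS; exact: fS.
by rewrite !upd_cons0 f0.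
Qed.

(** A repetition that involves the first entry can be brought to the first two places by a
    transposition of the tail. The condition [val i = 0%N] replaces [i = ord0] so that [k] may be
    any natural number. *)
Lemma alt_alternating_cons k (f : ('I_k.+1 -> V) -> K) :
    (forall w, multilinear (f \o fcons w)) ->
    (forall w, alternating (f \o fcons w)) ->
    (forall w (u : 'I_k -> V) i, val i = 0%N -> u i = w -> f (fcons w u) = 0) ->
  alternating f.
Proof.
move=> mS aS a0.
suff H (v : 'I_k.+1 -> V) j : v (lift ord0 j) = v ord0 -> f v = 0.
  move=> v i j; case: (unliftP ord0 i) (unliftP ord0 j) => [i' ->|->] [j' ->|->].
  - rewrite (inj_eq lift_inj) => ij' e; rewrite (fcons_eta v).
    exact: (aS (v ord0) (v \o lift ord0) i' j').
  - by move=> _ /H.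
  - by move=> _ /esym /H.
  - by rewrite eqxx.
rewrite (fcons_eta v) fconsS fcons0; move: (v ord0) (v \o lift ord0) => w u.
case: k f mS aS a0 j u {v} => [|k] f mS aS a0 j u uj; first by case: j {uj}.
have [j0|j0] := eqVneq j ord0.
  by apply: (a0 _ _ j) => //; rewrite j0.
apply/eqP; rewrite -oppr_eq0 -[- _](alt_tperm (mS w) (aS w) u j0) /=.
by apply/eqP/(a0 _ _ ord0) => //=; rewrite tpermR.
Qed.

(** * Exterior product with a linear form *)

Section Wedge.
Variable xi : V -> K.
Hypothesis xi_linear : forall a x y, xi (a *: x + y) = a * xi x + xi y.

Definition wedge_fun k (f : ('I_k -> V) -> K) (u : 'I_k.+1 -> V) : K :=
  \sum_(i < k.+1) (-1) ^+ i * (xi (u i) * f (u \o lift i)).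

Lemma wedge_fun0 (f : ('I_0 -> V) -> K) w u :
  wedge_fun f (fcons w u) = xi w * f u.
Proof.
by rewrite /wedge_fun big_ord1 expr0 mul1r fcons0 fcons_tail.
Qed.

(** Contraction is an antiderivation. Stated for arbitrary functions, since it is used to prove that
    the product is an alternating form in the first place. *)
Lemma wedge_fun_cons k (f : ('I_k.+1 -> V) -> K) w u :
  wedge_fun f (fcons w u) = xi w * f u - wedge_fun (f \o fcons w) u.
Proof.
rewrite /wedge_fun big_ord_recl expr0 mul1r fcons0 fcons_tail; congr (_ + _).
rewrite -sumrN; apply: eq_bigr => i _.
by rewrite fconsS fcons_lift -mulNr /= /bump /= add1n exprS mulN1r.
Qed.

Lemma wedge_fun_linear k a (f g h : ('I_k -> V) -> K) u :
  (forall v, h v = a * f v + g v) ->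
  wedge_fun h u = a * wedge_fun f u + wedge_fun g u.
Proof.
move=> E; rewrite /wedge_fun big_distrr -big_split /=; apply: eq_bigr => i _.
by rewrite E; ring.
Qed.

Lemma wedge_fun_alt k (p : alt_form V k) :
  multilinear (wedge_fun (alt_eval p)) /\ alternating (wedge_fun (alt_eval p)).
Proof.
elim: k p => [|k IH] p.
  have m1 : multilinear (wedge_fun (alt_eval p)).
    apply: alt_multilinear_cons => [u a w w'|w []//].
    by rewrite !wedge_fun0 xi_linear; ring.
  split=> // v i j; by rewrite !ord1.
have wE w : wedge_fun (alt_eval p) \o fcons w =
    fun u => xi w * alt_eval p u - wedge_fun (alt_eval (contract w p)) u.
  by apply/funext=> u /=; rewrite wedge_fun_cons.
have mS w : multilinear (wedge_fun (alt_eval p) \o fcons w).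
  move=> i v a x y; rewrite wE !updE.
  rewrite (multilinearP (@alt_form_multilinear _ p)).
  by rewrite (multilinearP (proj1 (IH (contract w p)))); ring.
have aS w : alternating (wedge_fun (alt_eval p) \o fcons w).
  move=> v i j ij vij; rewrite wE (@alt_form_alternating _ p _ _ _ ij vij).
  by rewrite (proj2 (IH (contract w p)) _ _ _ ij vij) mulr0 subr0.
split.
  apply: alt_multilinear_cons => // u a w w'; rewrite !wedge_fun_cons.
  rewrite (@wedge_fun_linear _ a (alt_eval p \o fcons w)
             (alt_eval p \o fcons w')).
    by rewrite xi_linear; ring.
  by move=> v /=; rewrite -!contractE contract_linear_vec.
(* With [w] in the first two places, expanding twice makes the terms in [xi w] cancel and leaves a
   double contraction with [w], which is 0. *)
apply: alt_alternating_cons => // w u i /= i0 uiw.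
have {}i0 : i = ord0 by apply/val_inj.
rewrite wedge_fun_cons -[_ \o _]/(alt_eval (contract w p)).
rewrite (fcons_eta u) -i0 uiw; set u' := u \o _; move: u' {uiw} => u'.
clear; case: k p u' => [|k] p u'.
  by rewrite wedge_fun0 contractE subrr.
rewrite wedge_fun_cons contractE opprB addrCA subrr addr0.
rewrite -[_ \o _]/(alt_eval (contract w (contract w p))) contract_contract.
by rewrite /wedge_fun big1 // => i _; rewrite alt_eval0 !mulr0.
Qed.

Definition wedge k (p : alt_form V k) : alt_form V k.+1 :=
  mk_alt (proj1 (wedge_fun_alt p)) (proj2 (wedge_fun_alt p)).

Fact wedge_is_linear k : linear (@wedge k).
Proof.
move=> a p q; apply: alt_form_ext => u.
exact: (@wedge_fun_linear _ a (alt_eval p) (alt_eval q)).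
Qed.

HB.instance Definition _ k :=
  GRing.isLinear.Build K (alt_form V k) (alt_form V k.+1) *:%R
    (@wedge k) (@wedge_is_linear k).

Lemma contract_wedge k w (p : alt_form V k.+1) :
  contract w (wedge p) = xi w *: p - wedge (contract w p).
Proof. by apply: alt_form_ext => u; exact: wedge_fun_cons. Qed.

Lemma contract_wedge0 w (p : alt_form V 0) : contract w (wedge p) = xi w *: p.
Proof. by apply: alt_form_ext => u; exact: wedge_fun0. Qed.

Lemma alt_form_contract_eq0 k (p : alt_form V k.+1) :
  (forall w, contract w p = 0) -> p = 0.
Proof.
by move=> p0; apply: alt_form_ext => u; rewrite (fcons_eta u) -contractE p0.
Qed.

(** A form of positive degree is 0 once all its contractions are. Contracting with [w], the terms in
    [xi w] cancel and the same claim for [contract w p] remains. *)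
Lemma wedge_wedge k (p : alt_form V k) : wedge (wedge p) = 0.
Proof.
elim: k p => [|k IH] p; apply: alt_form_contract_eq0 => w;
  rewrite contract_wedge.
  by rewrite contract_wedge0 linearZ /= subrr.
by rewrite contract_wedge linearB linearZ /= IH subr0 subrr.
Qed.

Variable e : V.
Hypothesis xi_e : xi e = 1.

Lemma wedge_inj0 (p : alt_form V 0) : wedge p = 0 -> p = 0.
Proof.
move=> p0; have := contract_wedge0 e p; rewrite p0 xi_e scale1r => <-.
exact: alt_form_ext.
Qed.

(* Contraction with e is a contracting homotopy. *)
Lemma wedge_exact k (p : alt_form V k.+1) :
  wedge p = 0 <-> exists q, p = wedge q.
Proof.
split=> [p0|[q ->]]; last exact: wedge_wedge.
exists (contract e p); have := contract_wedge e p.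
rewrite p0 xi_e scale1r => /esym/eqP; have -> : contract e 0 = 0 :> alt_form V k.+1.
  exact: alt_form_ext.
by rewrite subr_eq0 => /eqP.
Qed.

End Wedge.
End AltTheory.

(** * The Chevalley-Eilenberg differential of a Lie-Rinehart pair *)

Section LieRinehart.
Variables (A : comNzRingType) (G : lmodType A).
Variables (br : G -> G -> G) (anc : G -> A -> A).
Hypothesis brDl : forall u v w, br (u + v) w = br u w + br v w.
Hypothesis br_leibniz : forall u f v w,
  br u (f *: v + w) = f *: br u v + anc u f *: v + br u w.
Hypothesis br_alt : forall u, br u u = 0.
Hypothesis anc_linear : forall f u v g,
  anc (f *: u + v) g = f * anc u g + anc v g.
Hypothesis ancD : forall u f g, anc u (f + g) = anc u f + anc u g.
Hypothesis ancM : forall u f g, anc u (f * g) = f * anc u g + g * anc u f.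

Definition ce_anchor k (p : alt_form G k) (u : 'I_k.+1 -> G) : A :=
  \sum_(i < k.+1) (-1) ^+ i * anc (u i) (alt_eval p (u \o lift i)).

(** The indexing copies that of [koszul_bracket], so that the two formulas can be compared term by
    term. *)
Definition ce_bracket k : alt_form G k -> ('I_k.+1 -> G) -> A :=
  match k with
  | 0 => fun _ _ => 0
  | k'.+1 => fun p u =>
      \sum_(i < k'.+2) \sum_(j < k'.+1 | (i < lift i j)%N)
        (-1) ^+ (i + lift i j) *
        alt_eval p (fcons (br (u i) (u (lift i j)))
                      (fun q : 'I_k' => u (lift i (lift j q))))
  end.

Definition ce_fun k (p : alt_form G k) (u : 'I_k.+1 -> G) : A :=
  ce_anchor p u + ce_bracket p u.

(** The Lie derivative of [p] along [w]. *)
Definition lie k (w : G) (p : alt_form G k) (u : 'I_k -> G) : A :=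
  anc w (alt_eval p u) - \sum_(i < k) alt_eval p (upd u i (br w (u i))).

Local Notation ml p := (@alt_form_multilinear _ _ _ p).
Local Notation al p := (@alt_form_alternating _ _ _ p).

Lemma anc0 u : anc u 0 = 0.
Proof. by apply: (addrI (anc u 0)); rewrite -ancD !addr0. Qed.

Lemma br_antisym u v : br u v = - br v u.
Proof.
(* This is the Leibniz rule for the coefficient 1, which a derivation kills. *)
have brDr w x y : br w (x + y) = br w x + br w y.
  have := br_leibniz w 1 x y; rewrite !scale1r => ->.
  suff -> : anc w 1 = 0 by rewrite scale0r addr0.
  have := ancM w 1 1; rewrite !mulr1 !mul1r => /eqP.
  by rewrite -subr_eq subrr eq_sym => /eqP.
have := br_alt (u + v); rewrite brDl !brDr !br_alt add0r addr0 => /eqP.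
by rewrite addr_eq0 => /eqP.
Qed.

Lemma br_leibniz_l f w w' v :
  br (f *: w + w') v = f *: br w v - anc v f *: w + br w' v.
Proof.
by rewrite br_antisym br_leibniz !opprD -scalerN -!br_antisym.
Qed.

Lemma ce_fun0 (p : alt_form G 0) w u : ce_fun p (fcons w u) = anc w (alt_eval p u).
Proof.
by rewrite /ce_fun /ce_anchor addr0 big_ord1 expr0 mul1r fcons0 fcons_tail.
Qed.

(* Cartan's formula for the contraction with w. *)
Lemma ce_fun_cons k (p : alt_form G k.+1) w u :
  ce_fun p (fcons w u) = lie w p u - ce_fun (contract w p) u.
Proof.
rewrite /ce_fun /lie opprD addrACA; congr (_ + _).
  rewrite /ce_anchor big_ord_recl expr0 mul1r fcons0 fcons_tail; congr (_ + _).
  rewrite -sumrN; apply: eq_bigr => i _.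
  by rewrite fconsS fcons_lift -mulNr /= /bump /= add1n exprS mulN1r.
(* The pairs whose first index is 0 give the brackets [br w (u j)] of the Lie derivative, once
   [alt_move] has put them in the slot [j]. The other pairs give the bracket part for
   [contract w p]. *)
rewrite /ce_bracket big_ord_recl /=; congr (_ + _).
  rewrite -sumrN big_mkcond /=; apply: eq_bigr => j _.
  rewrite fcons0 fconsS /bump /=.
  have -> : (fun q : 'I_k => fcons w u (lift ord0 (lift j q))) = u \o lift j.
    by apply/funext=> q; rewrite fconsS.
  rewrite (alt_move (ml p) (al p)) add0n add1n exprS mulN1r mulNr.
  by rewrite signrMK.
case: k p u => [|k] p u.
  by rewrite oppr0 big_ord1 big1 // => -[[|j] ltj].
rewrite -sumrN; apply: eq_bigr => i _.
(* At [j = ord0] the second index is 0, so the guard fails and this summand disappears. *)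
rewrite big_mkcond big_ord_recl {1}/bump /= add0r.
rewrite [in RHS]big_mkcond -sumrN; apply: eq_bigr => j _.
have E : lift (lift ord0 i) (lift ord0 j) = lift ord0 (lift i j).
  by apply/val_inj; rewrite /= !bumpS.
rewrite E !fconsS /= /bump /= !add1n !addnS ltnS.
case: ifP => // _; last by rewrite oppr0.
(* Both indices are shifted by one, which leaves the sign unchanged; the minus sign comes from
   exchanging [w] with the bracket in front of it. *)
rewrite addSn !exprS !mulN1r opprK -mulrN; congr (_ * _).
rewrite -(alt_fcons_swap (ml p) (al p)); congr (alt_eval p (fcons _ _)).
have E' q : fcons w u (lift (lift ord0 i) q) = fcons w (u \o lift i) q.
  by rewrite -fcons_lift.
apply/funext=> q; rewrite E'.
rewrite -[fcons w _ _]/((fcons w (u \o lift i) \o lift (lift ord0 j)) q).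
by rewrite fcons_lift.
Qed.

(** Only the anchor terms differentiate [f], and the derivatives add up to the exterior product of
    [df] with [p]. *)
Lemma ce_funZD k f (p q : alt_form G k) u :
  ce_fun (f *: p + q) u =
  f * ce_fun p u + ce_fun q u + wedge_fun (anc^~ f) (alt_eval p) u.
Proof.
rewrite /ce_fun.
have -> : ce_anchor (f *: p + q) u =
    f * ce_anchor p u + ce_anchor q u + wedge_fun (anc^~ f) (alt_eval p) u.
  rewrite /ce_anchor /wedge_fun big_distrr -!big_split /=; apply: eq_bigr => i _.
  by rewrite alt_evalD alt_evalZ ancD ancM; ring.
have -> : ce_bracket (f *: p + q) u = f * ce_bracket p u + ce_bracket q u.
  case: k p q u => [|k] p q u; first by rewrite /= mulr0 addr0.
  rewrite /ce_bracket big_distrr -big_split /=; apply: eq_bigr => i _.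
  rewrite big_distrr -big_split /=; apply: eq_bigr => j _.
  by rewrite alt_evalD alt_evalZ; ring.
by ring.
Qed.

Lemma ce_fun_zero k u : ce_fun (0 : alt_form G k) u = 0.
Proof.
rewrite /ce_fun /ce_anchor big1 => [|i _]; last by rewrite alt_eval0 anc0 mulr0.
case: k u => [|k] u; first by rewrite addr0.
rewrite add0r; apply: big1 => i _; apply: big1 => j _.
by rewrite alt_eval0 mulr0.
Qed.

(** The term in [anc w f] from differentiating the value cancels the one that the Leibniz rule of
    the bracket produces in the slot [i]. *)
Lemma lie_multilinear k w (p : alt_form G k) : multilinear (lie w p).
Proof.
move=> i v f x y; rewrite !updE /lie !(bigD1 i (P := xpredT)) //=.
rewrite !upd_eq !upd_upd br_leibniz -addrA !(multilinearP (ml p)).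
rewrite ancD ancM.
have -> : \sum_(j < k | j != i)
    alt_eval p (upd (upd v i (f *: x + y)) j (br w (upd v i (f *: x + y) j))) =
  f * \sum_(j < k | j != i) alt_eval p (upd (upd v i x) j (br w (upd v i x j))) +
  \sum_(j < k | j != i) alt_eval p (upd (upd v i y) j (br w (upd v i y j))).
  rewrite big_distrr -big_split /=; apply: eq_bigr => j ji.
  rewrite !upd_neq // !(upd_swap _ _ _ (i := i) (j := j)) 1?eq_sym //.
  by rewrite (multilinearP (ml p)).
by ring.
Qed.

(** If the entries [i] and [j] agree, only the terms that alter one of these two slots survive, and
    they are opposite. *)
Lemma lie_alternating k w (p : alt_form G k) : alternating (lie w p).
Proof.
move=> v i j ij vij; rewrite /lie (al p ij vij) anc0 sub0r.
rewrite (bigD1 i) // (bigD1 j) 1?eq_sym //= big1 => [|l /andP[li lj]].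
  rewrite addr0 -vij -{1}(upd_id v j) upd_swap 1?eq_sym //.
  rewrite -vij -[in X in _ + X](upd_id v i) (alt_upd2 (ml p) (al p)) //.
  by rewrite upd_eq addNr oppr0.
by apply: (al p ij); rewrite !upd_neq // eq_sym.
Qed.

Lemma ce_fun_alt k (p : alt_form G k) :
  multilinear (ce_fun p) /\ alternating (ce_fun p).
Proof.
elim: k p => [|k IH] p.
  split; last by move=> v i j; rewrite !ord1.
  apply: alt_multilinear_cons => [u a w w'|w []//].
  by rewrite !ce_fun0 anc_linear.
have ceE w : ce_fun p \o fcons w = fun u => lie w p u - ce_fun (contract w p) u.
  by apply/funext=> u /=; rewrite ce_fun_cons.
have mS w : multilinear (ce_fun p \o fcons w).
  move=> i v a x y; rewrite ceE !updE.
  rewrite (multilinearP (@lie_multilinear _ w p)).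
  by rewrite (multilinearP (proj1 (IH (contract w p)))); ring.
have aS w : alternating (ce_fun p \o fcons w).
  move=> v i j ij vij; rewrite ceE (@lie_alternating _ w p _ _ _ ij vij).
  by rewrite (proj2 (IH (contract w p)) _ _ _ ij vij) subr0.
split.
  (* Neither term of Cartan's formula is linear over functions in [w]. The left Leibniz rule
     contributes the sum of [anc (u i) f * alt_eval p (upd u i w)] to the Lie derivative, and by
     [alt_move] this is the exterior product of [df] with [contract w p] that [ce_funZD] yields; the
     two cancel. *)
  apply: alt_multilinear_cons => // u f w w'; rewrite !ce_fun_cons.
  rewrite contract_linear_vec ce_funZD /lie anc_linear.
  have -> : wedge_fun (anc^~ f) (alt_eval (contract w p)) u =
      \sum_(i < k.+1) anc (u i) f * alt_eval p (upd u i w).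
    apply: eq_bigr => i _; rewrite contractE (alt_move (ml p) (al p)).
    by rewrite mulrCA signrMK.
  have -> : \sum_(i < k.+1) alt_eval p (upd u i (br (f *: w + w') (u i))) =
      f * (\sum_(i < k.+1) alt_eval p (upd u i (br w (u i)))) +
      \sum_(i < k.+1) alt_eval p (upd u i (br w' (u i))) -
      \sum_(i < k.+1) anc (u i) f * alt_eval p (upd u i w).
    rewrite big_distrr -sumrN -!big_split /=; apply: eq_bigr => i _.
    rewrite br_leibniz_l -(addrA (f *: _)) -scaleNr.
    by rewrite !(multilinearP (ml p)); ring.
  by ring.
apply: alt_alternating_cons => // w u i /= i0 uiw.
have {}i0 : i = ord0 by apply/val_inj.
rewrite (fcons_eta u) -i0 uiw; set u' := u \o _; move: u' {uiw} => u'.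
rewrite ce_fun_cons {IH ceE mS aS i i0 u}.
(* Because [br w w = 0], the Lie derivative along [w] commutes with the contraction with [w]. A
   second use of Cartan's formula then leaves only a double contraction. *)
have -> : lie w p (fcons w u') = lie w (contract w p) u'.
  rewrite /lie contractE big_ord_recl fcons0 upd_cons0 br_alt.
  rewrite -(upd_cons0 0 u' 0) (multilinear0 (ml p)) add0r; congr (_ - _).
  by apply: eq_bigr => i _; rewrite fconsS upd_consS.
case: k p u' => [|k] p u'.
  by rewrite ce_fun0 /lie big_ord0 subr0 subrr.
by rewrite ce_fun_cons contract_contract ce_fun_zero subr0 subrr.
Qed.

Definition ce_diff k (p : alt_form G k) : alt_form G k.+1 :=
  mk_alt (proj1 (ce_fun_alt p)) (proj2 (ce_fun_alt p)).

End LieRinehart.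

(** * Functions of class C^k and bump functions *)

Section CkTheory.
Variables (R : realType) (m : nat).
Implicit Types (U : set 'rV[R]_m) (f g : 'rV[R]_m -> R) (k : nat).

Lemma near_eq_differentiable (V W : normedModType R) (f g : V -> W) (x : V) :
  (\near x, f x = g x) -> differentiable f x -> differentiable g x.
Proof.
move=> fg /diff_locallyP[cf df].
have fgx : f x = g x by exact: nbhs_singleton fg.
have dg : g \o shift x = cst (g x) + 'd f x +o_ 0 id.
  apply/eqaddoP => e e0; have /eqaddoP/(_ e e0) := df.
  have fg0 : \forall y \near (0 : V), f (y + x) = g (y + x).
    rewrite (near_shift x 0) /=; apply: filterS fg => y.
    by rewrite /shift /= sub0r addrNK.
  apply: filterS2 fg0 => y fgy /=; rewrite !fctE /= /cst.
  by rewrite fgy fgx.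
apply/diff_locallyP; have -> // := @diff_unique _ _ _ g ('d f x) x.
Qed.

Lemma near_eq_continuous (S T : topologicalType) (f g : S -> T) (x : S) :
  (\near x, f x = g x) -> {for x, continuous f} -> {for x, continuous g}.
Proof.
move=> fg cf A Ag; have fgx : f x = g x by exact: nbhs_singleton fg.
rewrite -fgx in Ag; have := cf A Ag; apply: filterS2 fg => y fgy.
by rewrite /= fgy.
Qed.

Lemma Ck_sub k U V f : V `<=` U -> Ck k U f -> Ck k V f.
Proof.
elim: k f => [|k IH] f /= VU; first by move=> cf x /VU; exact: cf.
by move=> [df Df]; split=> [x /VU|i]; [exact: df|exact: IH].
Qed.

Lemma Ck_cover k U f :
  (forall x, U x -> exists2 V, V x & Ck k V f) -> Ck k U f.
Proof.
elim: k f => [|k IH] f /= Uf; first by move=> x /Uf[V Vx]; exact.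
split=> [x /Uf[V Vx [df _]]|i]; first exact: df.
by apply: IH => x /Uf[V Vx [_ Df]]; exists V.
Qed.

Lemma open_near_eq U f g x : open U -> (forall y, U y -> f y = g y) -> U x ->
  \near x, f x = g x.
Proof. by move=> oU fg Ux; apply: filterS (open_nbhs_nbhs (conj oU Ux)). Qed.

Lemma eq_Ck k U f g : open U -> (forall y, U y -> f y = g y) ->
  Ck k U f -> Ck k U g.
Proof.
move=> oU; elim: k f g => [|k IH] f g /= fg.
  move=> cf x Ux; apply: (near_eq_continuous (open_near_eq oU fg Ux)).
  exact: cf.
move=> [df Df]; split=> [x Ux|i].
  by apply: (near_eq_differentiable (open_near_eq oU fg Ux)); exact: df.
apply: IH (Df i) => y Uy; apply: (near_eq_derive _ (open_near_eq oU fg Uy)).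
Qed.

Lemma Ck_pred k U f : Ck k.+1 U f -> Ck k U f.
Proof.
elim: k f => [|k IH] f /=.
  by move=> [df _] x Ux; apply: differentiable_continuous; exact: df.
by move=> [df Df]; split=> // i; exact: IH (Df i).
Qed.

Lemma Ck_cst k U (c : R) : Ck k U (cst c).
Proof.
elim: k c => [|k IH] c /=; first by move=> x _; exact: cst_continuous.
split=> [x _|i]; first exact: differentiable_cst.
have -> : 'D_(delta_mx 0 i) (cst c) = cst 0 :> ('rV[R]_m -> R).
  by apply/funext=> x; rewrite derive_cst.
exact: IH.
Qed.

Lemma CkD k U f g : open U -> Ck k U f -> Ck k U g ->
  Ck k U (fun x => f x + g x).
Proof.
move=> oU; elim: k f g => [|k IH] f g /=.
  by move=> cf cg x Ux; apply: continuousD; [exact: cf|exact: cg].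
move=> [df Df] [dg Dg]; split=> [x Ux|i].
  by apply: differentiableD; [exact: df|exact: dg].
apply: (eq_Ck oU _ (IH _ _ (Df i) (Dg i))) => x Ux /=.
by rewrite deriveD //; apply: diff_derivable; [exact: df|exact: dg].
Qed.

Lemma CkM k U f g : open U -> Ck k U f -> Ck k U g ->
  Ck k U (fun x => f x * g x).
Proof.
move=> oU; elim: k f g => [|k IH] f g /=.
  by move=> cf cg x Ux; apply: continuousM; [exact: cf|exact: cg].
move=> /[dup] /Ck_pred cf [df Df] /[dup] /Ck_pred cg [dg Dg].
split=> [x Ux|i]; first by apply: differentiableM; [exact: df|exact: dg].
have := CkD oU (IH _ _ cf (Dg i)) (IH _ _ cg (Df i)).
apply: (eq_Ck oU) => x Ux /=.
by rewrite deriveM //; apply: diff_derivable; [exact: df|exact: dg].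
Qed.

Lemma Ck_sum k U (I : Type) (r : seq I) (F : I -> 'rV[R]_m -> R) : open U ->
  (forall i, Ck k U (F i)) -> Ck k U (fun x => \sum_(i <- r) F i x).
Proof.
move=> oU cF; elim: r => [|i r IH].
  by under eq_fun do rewrite big_nil; exact: Ck_cst.
by under eq_fun do rewrite big_cons; exact: CkD.
Qed.

(** By the chain rule, a derivative of [h i \o f] is [h (h' i) \o f] times a derivative of [f], so
    the induction on [k] treats the whole family at once. The family in view is [flat], indexed by
    polynomials. *)
Lemma Ck_comp_family (I : Type) (h : I -> R -> R) (h' : I -> I) k U f :
  (forall i t, is_derive t (1 : R) (h i) (h (h' i) t)) -> open U ->
  Ck k U f -> forall i, Ck k U (h i \o f).
Proof.
move=> hd oU; have dh i t : differentiable (h i) t.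
  by apply/derivable1_diffP; exact: ex_derive.
elim: k f => [|k IH] f /=.
  move=> cf i x Ux; apply: continuous_comp; first exact: cf.
  exact: differentiable_continuous.
move=> /[dup] /Ck_pred cf [df Df] i; split=> [x Ux|j].
  by apply: differentiable_comp => //; exact: df.
have := CkM oU (IH _ cf (h' i)) (Df j).
apply: (eq_Ck oU) => x Ux /=.
rewrite !deriveE //; [|exact: differentiable_comp (df _ Ux) _|exact: df].
rewrite (diff_comp (df _ Ux) (dh i (f x))).
have dhE t : 'd (h i) (f x) t = t * h (h' i) (f x).
  rewrite deriv1E; last exact: ex_derive.
  by rewrite derive1E derive_val.
by rewrite /= dhE mulrC.
Qed.

End CkTheory.

(** * Functions on the line that are flat at 0 *)

Section FlatFunction.
Variable R : realType.
Implicit Types (p : {poly R}) (t : R).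

(* The functions [P (1/t) exp (-1/t)], extended by 0 to the nonpositive half
   line, are stable under derivation. *)
Definition flat p t : R := if 0 < t then p.[t^-1] * expR (- t^-1) else 0.

(** With [s = 1/t] one has [ds/dt = - s^2], and the derivative of [p(s) exp(-s)] in [s] is
    [(p' - p)(s) exp(-s)]. *)
Definition flat_deriv p : {poly R} := 'X^2 * (p - p^`()).

Lemma horner_bound p : exists n (C : R), 0 <= C /\
  forall s, 1 <= s -> `|p.[s]| <= C * s ^+ n.
Proof.
elim/poly_ind: p => [|p c [n [C [C0 pC]]]].
  by exists 0%N, 0; split=> // s _; rewrite horner0 normr0 mul0r.
exists n.+1, (C + `|c|); split=> [|s s1]; first exact: addr_ge0.
have s0 : 0 <= s by apply: le_trans s1.
rewrite hornerD hornerM hornerX hornerC mulrDl.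
apply: le_trans (ler_normD _ _) _; apply: lerD; last first.
  by rewrite ler_peMr // exprn_ege1.
by rewrite normrM (ger0_norm s0) exprSr mulrA ler_wpM2r // pC.
Qed.

(** If [p(s)] grows at most like [s^n], the bound [exp s >= s^(n+1) / (n+1)!] from the exponential
    series leaves a factor [1/s = t]; this is where the factorial in the constant comes from. *)
Lemma flat_bound p : exists2 C : R, 0 <= C &
  forall t, t <= 1 -> `|flat p t| <= C * `|t|.
Proof.
have [n [C [C0 pC]]] := horner_bound p.
exists (C * n.+1`!%:R) => [|t t1]; first by rewrite mulr_ge0.
rewrite /flat; case: ifPn => [t0|_]; last by rewrite normr0 !mulr_ge0.
have s1 : 1 <= t^-1 by rewrite invf_ge1.
have s0 : 0 < t^-1 by rewrite invr_gt0.
rewrite normrM (gtr0_norm t0) (gtr0_norm (expR_gt0 _)) expRN.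
have E : t^-1 ^+ n.+1 / n.+1`!%:R <= expR t^-1.
  by apply: le_trans (expR_ge1Dxn n (ltW s0)); rewrite lerDr.
have F0 : 0 < t^-1 ^+ n.+1 / n.+1`!%:R :> R.
  by rewrite divr_gt0 ?exprn_gt0 // ltr0n fact_gt0.
apply: (@le_trans _ _ (C * t^-1 ^+ n * (t^-1 ^+ n.+1 / n.+1`!%:R)^-1)).
  apply: ler_pM; rewrite ?invr_ge0 ?expR_ge0 ?pC //.
  by rewrite lef_pV2 ?posrE ?expR_gt0.
have a0 : t^-1 ^+ n != 0 by rewrite expf_neq0 // gt_eqF.
have N0 : n.+1`!%:R != 0 :> R by rewrite pnatr_eq0 -lt0n fact_gt0.
rewrite exprS le_eqVlt; apply/orP; left; apply/eqP.
have tn0 : t != 0 by rewrite gt_eqF.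
by move: (t^-1 ^+ n) (n.+1`!%:R) a0 N0 => a N a0 N0; field; rewrite a0 N0 tn0.
Qed.

Lemma flat_le0 p t : t <= 0 -> flat p t = 0.
Proof. by rewrite /flat; case: ltP. Qed.

Lemma flat_continuous0 p : {for 0, continuous (flat p)}.
Proof.
have [C C0 pC] := flat_bound p.
change (flat p @ (0 : R) --> flat p 0); rewrite flat_le0 //.
apply/cvgrPdist_lt => e e0; near=> t.
rewrite sub0r normrN; apply: (@le_lt_trans _ _ (C * `|t|)).
  by apply: pC; rewrite ltW //; near: t; exact: lt_nbhsl.
have : `|t| < e / (C + 1).
  near: t; have /cvgrPdist_lt/(_ (e / (C + 1))) := @cvg_id _ (nbhs (0 : R)).
  have d0 : 0 < e / (C + 1) by rewrite divr_gt0 // ltr_wpDl.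
  by move=> /(_ d0); apply: filterS => t /=; rewrite sub0r normrN.
rewrite ltr_pdivlMr ?ltr_wpDl // => le; apply: le_lt_trans le.
by rewrite mulrC ler_wpM2l // lerDl.
Unshelve. all: by end_near. Qed.

Lemma is_derive_flat p t :
  is_derive t (1 : R) (flat p) (flat (flat_deriv p) t).
Proof.
have [t0|t0|->] := ltgtP t 0.
- rewrite flat_le0 1?ltW //; apply: (@near_eq_is_derive _ _ _ (cst 0)).
  near=> s; rewrite flat_le0 // ltW //; near: s; exact: lt_nbhsl.
- have tn0 : t != 0 by rewrite gt_eqF.
  have dV : is_derive t (1 : R) (fun s : R => s^-1) (- t ^- 2).
    have := @is_deriveV _ id t 1 1 tn0 (is_derive_id _ _).
    by rewrite scaler1.
  have dp := is_derive1_comp (is_derive_poly p t^-1) dV.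
  have dN := is_deriveN dV.
  have de := @is_derive1_comp _ expR (- (fun s : R => s^-1)) t _ _
    (is_derive_expR _) dN.
  have := is_deriveM dp de.
  have -> : flat (flat_deriv p) t =
      (horner p \o GRing.inv) t *: (expR (- t^-1) * - - t ^- 2) +
      (expR \o (- (fun s : R => s^-1))) t *: (p^`().[t^-1] * - t ^- 2).
    rewrite /flat t0 /flat_deriv hornerM hornerXn hornerD hornerN /=.
    by rewrite -![_ *: _]/(_ * _) fctE; field.
  apply: near_eq_is_derive.
  near=> s; rewrite /flat ifT //; near: s; exact: lt_nbhsr.
- rewrite flat_le0 //; apply/is_derive1_caratheodory.
  (* The difference quotient of [flat p] at 0 is [flat ('X * p)], so continuity at 0 of all
     functions of the family gives their differentiability there. *)
  exists (flat ('X * p)); split; last by rewrite flat_le0.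
    move=> z; rewrite [flat p 0]flat_le0 // !subr0 /flat; case: ifPn => z0;
      last by rewrite mul0r.
    by rewrite hornerM hornerX; field; rewrite gt_eqF.
  exact: flat_continuous0.
Unshelve. all: by end_near. Qed.

Lemma flat1_gt0 t : 0 < t -> 0 < flat 1 t.
Proof. by move=> t0; rewrite /flat t0 hornerC mul1r expR_gt0. Qed.

End FlatFunction.

(** * Bump functions on a manifold *)

Section Bump.
Variables (R : realType) (m : nat) (M : smoothManifold R m).

Lemma chart_preimage_open (c : chart R m M) (U : set M) : open U ->
  open (chart_cod c `&` chart_inv c @^-1` U).
Proof.
move=> oU; rewrite openE => y [cy Uy].
rewrite /interior; apply: filterI.
  by apply: open_nbhs_nbhs; split=> //; exact: chart_cod_open.
by apply: (chart_inv_continuous cy); apply: open_nbhs_nbhs.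
Qed.

(** A flat function is applied to [d ^+ 2 - q], where [q] is the squared Euclidean distance to [x]
    in a chart, a polynomial in the coordinates. The support lies in the image [K] of a compact
    ball; as M is Hausdorff, [K] is closed in M and not merely in the chart, so the extension by 0
    is smooth. *)
Lemma bump_exists (U : set M) (x : M) : open U -> U x ->
  exists chi : M -> R, [/\ smooth chi, chi x = 1 &
    exists K : set M, [/\ closed K, K `<=` U & forall y, ~ K y -> chi y = 0]].
Proof.
move=> oU Ux; have [c ac cx] := atlas_cover x.
pose y0 := chart_map c x.
pose q (y : 'rV[R]_m) := \sum_(i < m) (y 0 i - y0 0 i) ^+ 2.
have q0 : q y0 = 0 by rewrite /q big1 // => i _; rewrite subrr expr0n.
have oW := @chart_preimage_open c _ (openI (@chart_dom_open _ _ _ c) oU).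
have Wy0 : (chart_cod c `&` chart_inv c @^-1` (chart_dom c `&` U)) y0.
  by split; [exact: chart_map_cod|rewrite /= chart_mapK].
have [e /= e0 eW] : exists2 e : R, 0 < e & forall y, ball y0 e y ->
    (chart_cod c `&` chart_inv c @^-1` (chart_dom c `&` U)) y.
  have /nbhs_ballP[e /= e0 eW] := open_nbhs_nbhs (conj oW Wy0).
  by exists e.
(* The closed Euclidean ball of radius [d < e] lies inside the open ball of radius [e], which bounds
   each coordinate separately. *)
pose d := e / 2; have d0 : 0 < d by rewrite divr_gt0.
have de : d < e by rewrite ltr_pdivrMr // mulr_natr mulr2n ltrDl.
pose B := [set y | q y <= d ^+ 2].
have qd y i : B y -> `|y0 0 i - y 0 i| <= d.
  move=> qy; rewrite -ler_sqr ?nnegrE ?(ltW d0) // real_normK ?num_real //.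
  apply: le_trans qy; rewrite /q (bigD1 i) //= -sqrrN opprB lerDl sumr_ge0 //.
  by move=> l _; exact: sqr_ge0.
have BW y : B y -> (chart_cod c `&` chart_inv c @^-1` (chart_dom c `&` U)) y.
  move=> By; apply: eW; split=> // i j; rewrite ord1 /ball /=.
  exact: le_lt_trans (qd _ _ By) de.
have cq : continuous q.
  suff: Ck 0 setT q by move=> H y; exact: H.
  apply: Ck_sum => [|i]; first exact: openT.
  by apply: CkM; try exact: openT; apply: CkD; try exact: openT;
    try exact: Ck_cst; move=> y _; exact: coord_continuous.
have cB : compact B.
  have cI : compact [set v : 'rV[R]_m |
      forall i, v ord0 i \in `[(y0 0 i - d), (y0 0 i + d)]].
    apply: (@rV_compact _ _ (fun i => `[(y0 0 i - d), (y0 0 i + d)]%classic)).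
    by move=> i; exact: segment_compact.
  apply: subclosed_compact cI _.
    exact: ((continuous_closedP q).1 cq _ (@closed_le R (d ^+ 2))).
  by move=> y /qd yd i; rewrite in_itv /= -ler_distlC.
pose K := chart_inv c @` B.
have cK : closed K.
  apply: compact_closed; first exact: mfd_hausdorff.
  apply: continuous_compact cB; apply: continuous_in_subspaceT => y.
  by rewrite inE => /BW[cy _]; exact: chart_inv_continuous.
have KU : K `<=` U by move=> _ [y /BW[_ []] _ ? <-].
have Kdom : K `<=` chart_dom c by move=> _ [y /BW[_ []] ? _ <-].
pose a := (flat 1 (d ^+ 2))^-1.
pose chi z := if `[< chart_dom c z >] then flat 1 (d ^+ 2 - q (chart_map c z)) * a
              else 0.
have chiK y : ~ K y -> chi y = 0.
  rewrite /chi; case: asboolP => // cy Ky; rewrite flat_le0 ?mul0r //.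
  rewrite leNgt; apply/negP => H; apply: Ky; exists (chart_map c y).
    by rewrite /B /= -subr_ge0 ltW.
  exact: chart_mapK.
exists chi; split; last by exists K.
(* Smoothness is local: the formula applies on the domain of [c], and a point outside this domain
   has the open complement of [K] as a neighborhood, where the function is 0. *)
- move=> c' ac' k; apply: Ck_cover => y [cy _].
  have [cdy|ncdy] := pselect (chart_dom c (chart_inv c' y)).
    exists (chart_cod c' `&` chart_inv c' @^-1` chart_dom c) => //.
    have oV := @chart_preimage_open c' _ (@chart_dom_open _ _ _ c).
    set V := _ `&` _ in oV *.
    pose g y := d ^+ 2 + -1 * q (chart_map c (chart_inv c' y)).
    have cg : Ck k V g.
      apply: CkD => //; first exact: Ck_cst.
      apply: CkM => //; first exact: Ck_cst.
      apply: Ck_sum => // i; apply: CkM => //;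
        by apply: CkD => //; [exact: atlas_compat|exact: Ck_cst].
    have := CkM oV (Ck_comp_family (@is_derive_flat R) oV cg 1) (Ck_cst k V a).
    apply: (eq_Ck oV) => z [_ /= cz]; rewrite /chi asboolT //.
    by rewrite /g mulN1r.
  exists (chart_cod c' `&` chart_inv c' @^-1` (~` K)).
    by split=> //= /Kdom.
  have oV := @chart_preimage_open c' _ (closed_openC cK).
  apply: (eq_Ck oV _ (Ck_cst k _ 0)) => z [_ /= Kz].
  by rewrite /= chiK.
- rewrite /chi asboolT // -/y0 q0 subr0 divff // gt_eqF // flat1_gt0 //.
  by rewrite exprn_gt0.
Qed.

End Bump.

(** * Smooth functions and sections *)

Section SmoothFunctions.
Variables (R : realType) (m : nat) (M : smoothManifold R m).
Implicit Types (U V W : set M) (f g : M -> R).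

Lemma smooth_on_sub U V f : V `<=` U -> smooth_on U f -> smooth_on V f.
Proof.
move=> VU sf c ac k; apply: Ck_sub (sf c ac k) => y [cy Vy].
by split=> //; exact: VU.
Qed.

Lemma smooth_on_eq U f g : open U -> (forall y, U y -> f y = g y) ->
  smooth_on U f -> smooth_on U g.
Proof.
move=> oU fg sf c ac k.
apply: (eq_Ck (@chart_preimage_open _ _ _ c _ oU) _ (sf c ac k)).
by move=> y [_ Uy] /=; exact: fg.
Qed.

Lemma smooth_on_cst U (a : R) : smooth_on U (fun=> a).
Proof. by move=> c ac k; exact: Ck_cst. Qed.

Lemma smooth_onD U f g : open U -> smooth_on U f -> smooth_on U g ->
  smooth_on U (fun x => f x + g x).
Proof.
move=> oU sf sg c ac k; apply: CkD; [|exact: sf|exact: sg].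
exact: chart_preimage_open.
Qed.

Lemma smooth_onM U f g : open U -> smooth_on U f -> smooth_on U g ->
  smooth_on U (fun x => f x * g x).
Proof.
move=> oU sf sg c ac k; apply: CkM; [|exact: sf|exact: sg].
exact: chart_preimage_open.
Qed.

Lemma smooth_onB U f g : open U -> smooth_on U f -> smooth_on U g ->
  smooth_on U (fun x => f x - g x).
Proof.
move=> oU sf sg.
have := smooth_onD oU sf (smooth_onM oU (smooth_on_cst U (-1)) sg).
by apply: smooth_on_eq => // y _; rewrite mulN1r.
Qed.

Definition supported_in U f := exists K : set M,
  [/\ closed K, K `<=` U & forall y, ~ K y -> f y = 0].

Lemma supported_in_eq0 U f y : supported_in U f -> ~ U y -> f y = 0.
Proof. by move=> [K [_ KU K0]] nU; apply: K0 => /KU. Qed.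

(** W is covered by [U] and the complement of [K], which is open because the support condition
    provides a closed [K]; there the product is 0 whatever [f] is. *)
Lemma smooth_onM_supported U W chi f : open U -> open W -> smooth chi ->
  supported_in U chi -> smooth_on (U `&` W) f ->
  smooth_on W (fun x => chi x * f x).
Proof.
move=> oU oW schi [K [cK KU K0]] sf c ac k; apply: Ck_cover => y [cy Wy].
have [Uy|nUy] := pselect (U (chart_inv c y)).
  exists (chart_cod c `&` chart_inv c @^-1` (U `&` W)) => //.
  apply: smooth_onM => //; first exact: openI.
  exact: smooth_on_sub schi.
exists (chart_cod c `&` chart_inv c @^-1` (~` K)).
  by split=> //= /KU.
have oV := @chart_preimage_open _ _ _ c _ (closed_openC cK).
by apply: (eq_Ck oV _ (Ck_cst k _ 0)) => z [_ /= Kz] /=; rewrite K0 ?mul0r.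
Qed.

Implicit Types (F G : M -> R[i]).

Lemma csmooth_on_cst U (a : R[i]) : csmooth_on U (fun=> a).
Proof. by split; exact: smooth_on_cst. Qed.

Lemma csmooth_onB U F G : open U -> csmooth_on U F -> csmooth_on U G ->
  csmooth_on U (fun x => F x - G x).
Proof.
move=> oU [F1 F2] [G1 G2]; split.
  apply: (smooth_on_eq oU _ (smooth_onB oU F1 G1)) => y _.
  by rewrite /=; case: (F y) => ? ?; case: (G y).
apply: (smooth_on_eq oU _ (smooth_onB oU F2 G2)) => y _.
by rewrite /=; case: (F y) => ? ?; case: (G y).
Qed.

Lemma csmooth_onM U F G : open U -> csmooth_on U F -> csmooth_on U G ->
  csmooth_on U (fun x => F x * G x).
Proof.
move=> oU [F1 F2] [G1 G2]; split.
  apply: (smooth_on_eq oU _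
    (smooth_onB oU (smooth_onM oU F1 G1) (smooth_onM oU F2 G2))) => y _.
  by rewrite /=; case: (F y) => ? ?; case: (G y).
apply: (smooth_on_eq oU _
  (smooth_onD oU (smooth_onM oU F1 G2) (smooth_onM oU F2 G1))) => y _.
by rewrite /=; case: (F y) => ? ?; case: (G y).
Qed.

Lemma csmooth_real U f : smooth_on U f -> csmooth_on U (fun x => (f x)%:C).
Proof. by split=> //; exact: smooth_on_cst. Qed.

End SmoothFunctions.

Section SmoothSections.
Variables (R : realType) (m : nat) (M : smoothManifold R m).
Variable E : vbundle M.
Implicit Types (U V W : set M) (s t : forall x, E x).

Lemma smooth_section_onDZ U (f g : M -> R) s t : open U ->
  smooth_on U f -> smooth_on U g ->
  smooth_section_on U s -> smooth_section_on U t ->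
  smooth_section_on U (fun x => f x *: s x + g x *: t x).
Proof.
move=> oU sf sg ss st e fe.
have [a [sa sE]] := ss e fe; have [b [sb tE]] := st e fe.
have oV : open (U `&` frame_dom e) by apply: openI => //; exact: frames_open fe.
exists (fun i x => f x * a i x + g x * b i x); split=> [i|x Ux].
  apply: smooth_onD => //; apply: smooth_onM => //;
    by apply: smooth_on_sub; [exact: subIsetl|].
rewrite sE // tE // !scaler_sumr -big_split /=; apply: eq_bigr => i _.
by rewrite scalerDl !scalerA.
Qed.

Lemma smooth_section_on0 U : smooth_section_on U (fun x => 0 : E x).
Proof.
move=> e fe; exists (fun _ _ => 0); split=> [i|x _].
  exact: smooth_on_cst.
by rewrite big1 // => i _; rewrite scale0r.
Qed.

Lemma smooth_section_onZ U (f : M -> R) s : open U ->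
  smooth_on U f -> smooth_section_on U s ->
  smooth_section_on U (fun x => f x *: s x).
Proof.
move=> oU sf ss.
have := smooth_section_onDZ oU sf (smooth_on_cst U 0) ss (smooth_section_on0 U).
by congr smooth_section_on; apply/functional_extensionality_dep => x;
  rewrite scaler0 addr0.
Qed.

Lemma smooth_section_onD U s t : open U ->
  smooth_section_on U s -> smooth_section_on U t ->
  smooth_section_on U (fun x => s x + t x).
Proof.
move=> oU ss st; have s1 := smooth_on_cst U (1 : R).
have := smooth_section_onDZ oU s1 s1 ss st.
by congr smooth_section_on; apply/functional_extensionality_dep => x;
  rewrite !scale1r.
Qed.

Lemma smooth_section_onB U s t : open U ->
  smooth_section_on U s -> smooth_section_on U t ->
  smooth_section_on U (fun x => s x - t x).
Proof.
move=> oU ss st.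
have := smooth_section_onDZ oU (smooth_on_cst U (1 : R))
  (smooth_on_cst U (-1 : R)) ss st.
by congr smooth_section_on; apply/functional_extensionality_dep => x;
  rewrite scaleN1r scale1r.
Qed.

Lemma smooth_section_on_sum U (I : Type) (r : seq I) (s : I -> forall x, E x) :
  open U -> (forall i, smooth_section_on U (s i)) ->
  smooth_section_on U (fun x => \sum_(i <- r) s i x).
Proof.
move=> oU ss; elim: r => [|i r IH].
  have := smooth_section_on0 U.
  by congr smooth_section_on; apply/functional_extensionality_dep => x;
    rewrite big_nil.
have := smooth_section_onD oU (ss i) IH.
by congr smooth_section_on; apply/functional_extensionality_dep => x;
  rewrite big_cons.
Qed.

Lemma smooth_section_supported U (chi : M -> R) s : open U -> smooth chi ->
  supported_in U chi -> smooth_section_on U s ->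
  smooth_section (fun x => chi x *: s x).
Proof.
move=> oU schi chiU ss e fe; have [a [sa sE]] := ss e fe.
have oe : open (frame_dom e) by exact: frames_open fe.
exists (fun i x => chi x * a i x); split=> [i|x [_ ex]].
  by rewrite setTI; exact: smooth_onM_supported chiU (sa i).
have [Ux|/(supported_in_eq0 chiU) ->] := pselect (U x).
  by rewrite sE // scaler_sumr; apply: eq_bigr => i _; rewrite scalerA.
by rewrite scale0r big1 // => i _; rewrite mul0r scale0r.
Qed.

(** A combination of local frame vectors with constant coefficients, cut off by a bump function. *)
Lemma smooth_section_through x (v : E x) :
  exists2 s, smooth_section s & s x = v.
Proof.
have [e fe ex] := frames_cover E x.
have oe : open (frame_dom e) by exact: frames_open fe.
have [chi [schi chix chiU]] := bump_exists oe ex.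
have [a [va _]] := frames_basis fe ex v.
exists (fun y => \sum_(i < frame_rank e) a i *: (chi y *: frame_vec i y)).
  apply: smooth_section_on_sum => [|i]; first exact: openT.
  apply: smooth_section_onZ; [exact: openT|exact: smooth_on_cst|].
  apply: smooth_section_supported chiU _ => // e' fe'.
  exact: frames_compat fe i.
by rewrite va; apply: eq_bigr => i _; rewrite chix scale1r.
Qed.

End SmoothSections.

Section ComplexSections.
Variables (R : realType) (m : nat) (M : smoothManifold R m).
Variable E : vbundle M.
Implicit Types (U V W : set M) (s t : forall x, cplx (E x)) (F : M -> R[i]).

Lemma csmooth_section_onD U s t : open U ->
  csmooth_section_on U s -> csmooth_section_on U t ->
  csmooth_section_on U (fun x => s x + t x).
Proof.
by move=> oU [s1 s2] [t1 t2]; split; apply: smooth_section_onD.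
Qed.

Lemma csmooth_section_on0 U : csmooth_section_on U (fun x => 0 : cplx (E x)).
Proof. by split; exact: smooth_section_on0. Qed.

Lemma csmooth_section_onZ U F s : open U ->
  csmooth_on U F -> csmooth_section_on U s ->
  csmooth_section_on U (fun x => F x *: s x).
Proof.
move=> oU [F1 F2] [s1 s2]; split.
  by apply: smooth_section_onB => //; apply: smooth_section_onZ.
by apply: smooth_section_onD => //; apply: smooth_section_onZ.
Qed.

Lemma csmooth_section_supported U (chi : M -> R) s : open U -> smooth chi ->
  supported_in U chi -> csmooth_section_on U s ->
  csmooth_section (fun x => (chi x)%:C *: s x).
Proof.
move=> oU schi chiU [s1 s2]; split.
  have := smooth_section_supported oU schi chiU s1.
  by congr smooth_section_on; apply/functional_extensionality_dep => x;
    rewrite /= scale0r subr0.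
have := smooth_section_supported oU schi chiU s2.
by congr smooth_section_on; apply/functional_extensionality_dep => x;
  rewrite /= scale0r addr0.
Qed.

End ComplexSections.

(** * Calculus in a complexified Courant algebroid *)

Section Derivations.
Variables (R : realType) (m : nat) (M : smoothManifold R m) (x : M).
Implicit Types (X Y : tangent x) (f g : M -> R).

Lemma der_derivation X : derivation_at x (der X).
Proof. by have /asboolP := valP X. Qed.

Lemma derDZ X (a : R) f g : smooth f -> smooth g ->
  der X (fun y => a * f y + g y) = a * der X f + der X g.
Proof. by have [_ + _] := der_derivation X; apply. Qed.

Lemma derM X f g : smooth f -> smooth g ->
  der X (fun y => f y * g y) = f x * der X g + g x * der X f.
Proof. by have [_ _] := der_derivation X; apply. Qed.

Lemma derD X f g : smooth f -> smooth g ->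
  der X (fun y => f y + g y) = der X f + der X g.
Proof.
move=> sf sg; rewrite -[der X f]mul1r -derDZ //; congr (der X _).
by apply/funext => y; rewrite mul1r.
Qed.

Lemma derB X f g : smooth f -> smooth g ->
  der X (fun y => f y - g y) = der X f - der X g.
Proof.
move=> sf sg; rewrite addrC -mulN1r -derDZ //; congr (der X _).
by apply/funext => y; rewrite mulN1r addrC.
Qed.

Lemma der0 X : der X (fun=> 0) = 0.
Proof.
have s0 : smooth (fun _ : M => 0 : R) by exact: smooth_on_cst.
have := derD X s0 s0; rewrite addr0 => /eqP.
by rewrite -subr_eq subrr eq_sym => /eqP.
Qed.

Lemma derDl X Y f : der (X + Y) f = der X f + der Y f.
Proof. by []. Qed.

Lemma derZl a X f : der (a *: X) f = a * der X f.
Proof. by []. Qed.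

Lemma derNl X f : der (- X) f = - der X f.
Proof. by []. Qed.

Definition derE := (derDl, derZl, derNl).

End Derivations.

Section CourantTheory.
Variables (R : realType) (m : nat) (M : smoothManifold R m).
Variable E : courantAlgebroid M.
Local Notation pairing := (@pairing _ _ _ E _).
Local Notation bracket := (@bracket _ _ _ E).

Lemma pairingDl x (u v w : E x) : pairing (u + v) w = pairing u w + pairing v w.
Proof. by rewrite -[u]scale1r pairing_linear mul1r scale1r. Qed.

Lemma pairing0l x (w : E x) : pairing 0 w = 0.
Proof.
have := pairingDl 0 0 w; rewrite addr0 => /eqP.
by rewrite -subr_eq subrr eq_sym => /eqP.
Qed.

Lemma pairingZl x a (u w : E x) : pairing (a *: u) w = a * pairing u w.
Proof. by rewrite -[a *: u]addr0 pairing_linear pairing0l addr0. Qed.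

Lemma pairingNl x (u w : E x) : pairing (- u) w = - pairing u w.
Proof. by rewrite -scaleN1r pairingZl mulN1r. Qed.

Lemma pairingDr x (u v w : E x) : pairing w (u + v) = pairing w u + pairing w v.
Proof. by rewrite !(pairing_sym w) pairingDl. Qed.

Lemma pairingZr x a (u w : E x) : pairing w (a *: u) = a * pairing w u.
Proof. by rewrite !(pairing_sym w) pairingZl. Qed.

Lemma pairingNr x (u w : E x) : pairing w (- u) = - pairing w u.
Proof. by rewrite !(pairing_sym w) pairingNl. Qed.

Definition pairingE :=
  (pairingDl, pairingDr, pairingZl, pairingZr, pairingNl, pairingNr).

Lemma pairing_ext x (u v : E x) :
  (forall w, pairing u w = pairing v w) -> u = v.
Proof.
move=> uv; apply/eqP; rewrite -subr_eq0; apply/eqP/pairing_nondegenerate => w.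
by rewrite !pairingE uv subrr.
Qed.

(** The axioms control brackets only through pairings with smooth sections; these take all values at
    [x], so nondegeneracy applies. *)
Lemma pairing_ext_section x (u v : E x) :
  (forall t, smooth_section t -> pairing u (t x) = pairing v (t x)) -> u = v.
Proof.
move=> uv; apply: pairing_ext => w.
by have [t /uv + <-] := smooth_section_through w.
Qed.

Lemma smooth_pairing (s t : forall x, E x) : smooth_section s ->
  smooth_section t -> smooth (fun x => pairing (s x) (t x)).
Proof. by move=> ss st; apply: pairing_smooth => //; exact: openT. Qed.

Lemma bracketDl s s' t x : smooth_section s -> smooth_section s' ->
  smooth_section t ->
  bracket (fun y => s y + s' y) t x = bracket s t x + bracket s' t x.
Proof.
move=> ss ss' st; rewrite -[bracket s t x]scale1r -bracket_linear_l //.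
by congr (bracket _ _ x); apply/functional_extensionality_dep => y; rewrite scale1r.
Qed.

Lemma bracketDr s t t' x : smooth_section s -> smooth_section t ->
  smooth_section t' ->
  bracket s (fun y => t y + t' y) x = bracket s t x + bracket s t' x.
Proof.
move=> ss st st'; rewrite -[bracket s t x]scale1r -bracket_linear_r //.
by congr (bracket _ _ x); apply/functional_extensionality_dep => y; rewrite scale1r.
Qed.

Lemma bracket_leibniz (f : M -> R) s t x : smooth f -> smooth_section s ->
  smooth_section t ->
  bracket s (fun y => f y *: t y) x =
  f x *: bracket s t x + der (anchor E x (s x)) f *: t x.
Proof.
move=> sf ss st; apply: pairing_ext_section => r sr.
have sft : smooth_section (fun y => f y *: t y).
  by apply: smooth_section_onZ => //; exact: openT.
(* The pairing of [f t] with [r] is differentiated along [s] in two ways: by invariance applied to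
   [f t], and by the product rule followed by invariance applied to [t]. *)
have := bracket_pairing ss sft sr x.
have -> : (fun y => pairing (f y *: t y) (r y)) =
    (fun y => f y * pairing (t y) (r y)).
  by apply/funext => y; rewrite pairingZl.
rewrite derM //; last exact: smooth_pairing.
rewrite bracket_pairing // => H.
apply: (addIr (pairing (f x *: t x) (bracket s r x))); rewrite -H.
by rewrite !pairingE; ring.
Qed.

(** The real and imaginary parts of a complex function times a complex section have two terms each;
    this is their common shape. *)
Lemma bracket_leibniz2 (f g : M -> R) s t r w x : smooth f -> smooth g ->
  smooth_section s -> smooth_section t -> smooth_section r ->
  smooth_section w ->
  bracket s (fun y => f y *: t y + g y *: r y + w y) x =
  (f x *: bracket s t x + der (anchor E x (s x)) f *: t x) +
  (g x *: bracket s r x + der (anchor E x (s x)) g *: r x) + bracket s w x.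
Proof.
move=> sf sg ss st sr sw.
have sft : smooth_section (fun y => f y *: t y).
  by apply: smooth_section_onZ => //; exact: openT.
have sgr : smooth_section (fun y => g y *: r y).
  by apply: smooth_section_onZ => //; exact: openT.
rewrite (@bracketDr s (fun y => f y *: t y + g y *: r y)) //; last first.
  by apply: smooth_section_onD => //; exact: openT.
by rewrite bracketDr // !bracket_leibniz.
Qed.

Implicit Types (s t w : forall x, cplx (E x)) (F G : M -> R[i]).
Local Notation csmooth F := (csmooth_on setT F).
Local Notation cder := (@cder _ _ _ E _).

Lemma eq_cplx (a b : R[i]) :
  complex.Re a = complex.Re b -> complex.Im a = complex.Im b -> a = b.
Proof. by case: a b => [? ?] [? ?] /= -> ->. Qed.

Lemma cder_linear x a (u v : cplx (E x)) F :
  cder (a *: u + v) F = a * cder u F + cder v F.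
Proof.
case: a => a1 a2; rewrite /Defs.cder /=.
rewrite !(linearD (anchor E x)) !(linearN (anchor E x)) !(linearZ_LR (anchor E x)).
by rewrite !derE; apply: eq_cplx => /=; ring.
Qed.

Lemma ReM (a b : R[i]) : complex.Re (a * b) =
  complex.Re a * complex.Re b - complex.Im a * complex.Im b.
Proof. by case: a b => [? ?] [? ?]. Qed.

Lemma ImM (a b : R[i]) : complex.Im (a * b) =
  complex.Re a * complex.Im b + complex.Im a * complex.Re b.
Proof. by case: a b => [? ?] [? ?]. Qed.

Lemma ReD (a b : R[i]) : complex.Re (a + b) = complex.Re a + complex.Re b.
Proof. by case: a b => [? ?] [? ?]. Qed.

Lemma ImD (a b : R[i]) : complex.Im (a + b) = complex.Im a + complex.Im b.
Proof. by case: a b => [? ?] [? ?]. Qed.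

Lemma cderD x (u : cplx (E x)) F G : csmooth F -> csmooth G ->
  cder u (fun y => F y + G y) = cder u F + cder u G.
Proof.
move=> [F1 F2] [G1 G2]; rewrite /Defs.cder.
have -> : (fun y => complex.Re (F y + G y)) =
  (fun y => complex.Re (F y) + complex.Re (G y)) by apply/funext => y; exact: ReD.
have -> : (fun y => complex.Im (F y + G y)) =
  (fun y => complex.Im (F y) + complex.Im (G y)) by apply/funext => y; exact: ImD.
by rewrite !derD //; apply: eq_cplx => /=; ring.
Qed.

Lemma cderM x (u : cplx (E x)) F G : csmooth F -> csmooth G ->
  cder u (fun y => F y * G y) = F x * cder u G + G x * cder u F.
Proof.
move=> [F1 F2] [G1 G2]; rewrite /Defs.cder.
have -> : (fun y => complex.Re (F y * G y)) =
    (fun y => complex.Re (F y) * complex.Re (G y) -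
              complex.Im (F y) * complex.Im (G y)).
  by apply/funext => y; exact: ReM.
have -> : (fun y => complex.Im (F y * G y)) =
    (fun y => complex.Re (F y) * complex.Im (G y) +
              complex.Im (F y) * complex.Re (G y)).
  by apply/funext => y; exact: ImM.
have oT : open [set: M] by exact: openT.
have M11 := smooth_onM oT F1 G1; have M22 := smooth_onM oT F2 G2.
have M12 := smooth_onM oT F1 G2; have M21 := smooth_onM oT F2 G1.
rewrite !(derB _ M11 M22) !(derD _ M12 M21) !derM //.
by apply: eq_cplx; rewrite ?(ReD, ImD, ReM, ImM) /=; ring.
Qed.

Lemma cder_real x (u : cplx (E x)) (f : M -> R) :
  cder u (fun y => (f y)%:C) =
  der (anchor E x u.1) f +i* der (anchor E x u.2) f.
Proof. by rewrite /Defs.cder /= !der0 subr0 add0r. Qed.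

Lemma cder_smooth s F : csmooth_section s -> csmooth F ->
  csmooth (fun x => cder (s x) F).
Proof.
move=> [s1 s2] [F1 F2]; have oT : open [set: M] by exact: openT.
split; [apply: smooth_onB => //|apply: smooth_onD => //];
  exact: anchor_smooth.
Qed.

Lemma cbracket_smooth s t : csmooth_section s -> csmooth_section t ->
  csmooth_section (cbracket s t).
Proof.
move=> [s1 s2] [t1 t2]; have oT : open [set: M] by exact: openT.
split; [apply: smooth_section_onB => //|apply: smooth_section_onD => //];
  exact: bracket_smooth.
Qed.

Lemma cbracketDl s s' t x : csmooth_section s -> csmooth_section s' ->
  csmooth_section t ->
  cbracket (fun y => s y + s' y) t x = cbracket s t x + cbracket s' t x.
Proof.
move=> [s1 s2] [s1' s2'] [t1 t2]; rewrite /cbracket /= !bracketDl //.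
congr (_, _); last by rewrite addrACA.
by rewrite opprD addrACA.
Qed.

Lemma cbracket_leibniz F s t w x : csmooth F -> csmooth_section s ->
  csmooth_section t -> csmooth_section w ->
  cbracket s (fun y => F y *: t y + w y) x =
  F x *: cbracket s t x + cder (s x) F *: t x + cbracket s w x.
Proof.
move=> [F1 F2] [s1 s2] [t1 t2] [w1 w2].
have NF2 : smooth (fun y => - complex.Im (F y)).
  have := smooth_onM (@openT M) (smooth_on_cst setT (-1)) F2.
  by congr smooth_on; apply/funext => y; rewrite mulN1r.
rewrite /cbracket /=.
have -> : (fun y => (F y *: t y + w y).1) = (fun y =>
    complex.Re (F y) *: (t y).1 + (- complex.Im (F y)) *: (t y).2 + (w y).1).
  by apply/functional_extensionality_dep => y; rewrite /= scaleNr.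
rewrite !bracket_leibniz2 //.
have derN X : der X (fun y => - complex.Im (F y)) =
    - der X (fun y => complex.Im (F y)) :> R.
  have := derDZ X (-1) F2 (smooth_on_cst setT 0).
  rewrite der0 mulN1r addr0 => <-; congr (der _ _).
  by apply/funext => y; rewrite mulN1r addr0.
(* Pairing with an arbitrary vector turns the identity of vectors into one between real numbers,
   within reach of [ring]. *)
rewrite !derN; congr (_, _); apply: pairing_ext => z /=; rewrite !pairingE /=;
  rewrite ?(ReD, ImD, ReM, ImM) /=; ring.
Qed.

(** The symmetric part of the bracket is governed by derivatives of the pairing. For
    [s = s1 + i s2], isotropy says that [s1] and [s2] have equal squares and are orthogonal. The
    first relation gives [[s1, s1] = [s2, s2]], the second [[s1, s2] + [s2, s1] = 0]. *)
Lemma cbracket_self s x : csmooth_section s ->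
  (forall y, cpairing (s y) (s y) = 0) -> cbracket s s x = 0.
Proof.
move=> [s1 s2] s0.
have p1 y : pairing (s y).1 (s y).1 = pairing (s y).2 (s y).2.
  by have /(congr1 (@complex.Re R)) /= /eqP := s0 y; rewrite subr_eq0 => /eqP.
have p2 y : pairing (s y).1 (s y).2 = 0.
  have /(congr1 (@complex.Im R)) /= /eqP := s0 y.
  rewrite (pairing_sym (s y).2) -mulr2n mulrn_eq0 /= => /eqP //.
rewrite /cbracket; congr (_, _); apply: pairing_ext_section => r sr.
  have H1 := bracket_sym s1 s1 sr x; have H2 := bracket_sym s2 s2 sr x.
  have E12 : der (anchor E x (r x)) (fun y => pairing (s y).1 (s y).1) =
      der (anchor E x (r x)) (fun y => pairing (s y).2 (s y).2).
    by congr der; apply/funext => y.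
  rewrite E12 -H2 !pairingE in H1; rewrite !pairingE pairing0l.
  (* [bracket_sym] with equal arguments controls twice the bracket, hence the division by 2. *)
  by apply/eqP; rewrite subr_eq0 -(eqr_pMn2r (n := 2)) // !mulr2n H1.
rewrite bracket_sym // pairing0l.
by under eq_fun do rewrite p2; rewrite der0.
Qed.

End CourantTheory.

(** * Sections of L as a module over the smooth functions *)

Section SmoothRing.
Variables (R : realType) (m : nat) (M : smoothManifold R m).

Definition csmooth_pred : {pred M -> R[i]} :=
  [pred F | `[< csmooth_on setT F >]].

Fact csmooth_subring_closed : subring_closed csmooth_pred.
Proof.
have oT : open [set: M] by exact: openT.
split=> [|F G /asboolP sF /asboolP sG|F G /asboolP sF /asboolP sG];
  apply/asboolP; [exact: csmooth_on_cst|exact: csmooth_onB|exact: csmooth_onM].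
Qed.

HB.instance Definition _ := GRing.isSubringClosed.Build (M -> R[i])
  csmooth_pred csmooth_subring_closed.

(* The point is only there to make the ring nonzero. *)
Definition smooth_ring (x0 : M) : Type := {F : M -> R[i] | F \in csmooth_pred}.

Variable x0 : M.
Local Notation A := (smooth_ring x0).

HB.instance Definition _ := SubChoice.on A.
HB.instance Definition _ := GRing.SubChoice_isSubComPzRing.Build
  (M -> R[i]) csmooth_pred A csmooth_subring_closed.

Fact smooth_ring_oner_neq0 : (1 : A) != 0.
Proof.
apply/eqP => /(congr1 (fun F : A => \val F x0)) /eqP.
by rewrite oner_eq0.
Qed.

HB.instance Definition _ :=
  GRing.PzSemiRing_isNonZero.Build A smooth_ring_oner_neq0.

Definition mk_smooth (F : M -> R[i]) (sF : csmooth_on setT F) : A :=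
  exist _ F (introT (asboolP _) sF).

Lemma smooth_ringP (F : A) : csmooth_on setT (\val F).
Proof. exact: (asboolP _ (valP F)). Qed.

(** Declared below as a ring morphism, so that determinants and adjugates over the ring of functions
    can be read at a point through [map_mx]. *)
Definition ev (x : M) (F : A) : R[i] := \val F x.

Fact ev_is_zmod_morphism x : zmod_morphism (ev x).
Proof. by []. Qed.

Fact ev_is_monoid_morphism x : monoid_morphism (ev x).
Proof. by []. Qed.

HB.instance Definition _ x := GRing.isZmodMorphism.Build A R[i] (ev x)
  (@ev_is_zmod_morphism x).
HB.instance Definition _ x := GRing.isMonoidMorphism.Build A R[i] (ev x)
  (@ev_is_monoid_morphism x).

Lemma smooth_ring_ext (F G : A) : (forall x, ev x F = ev x G) -> F = G.
Proof. by move=> FG; apply/val_inj/funext. Qed.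

End SmoothRing.

Section SmoothSectionsOfL.
Variables (R : realType) (m : nat) (M : smoothManifold R m).
Variables (E : courantAlgebroid M) (L : generalizedComplex E) (x0 : M).
Local Notation A := (smooth_ring x0).

(** The parameter [y] ties this type to the ring [smooth_ring y] that acts on it. *)
Record lsec (y : M) := LSec {
  lsec_fun :> forall x, subspace (L x);
  lsec_smooth : lsmooth_on setT lsec_fun }.

Local Notation G := (lsec x0).

Lemma lsec_ext (u v : G) : (forall x, u x = v x) -> u = v.
Proof.
case: u v => [u su] [v sv] /= uv.
have {}uv : u = v by apply/functional_extensionality_dep.
by case: _ / uv sv => sv; congr LSec; exact: Prop_irrelevance.
Qed.

Let oT : open [set: M] := @openT M.

Fact lsec_zero_smooth : lsmooth_on setT (fun x => 0 : subspace (L x)).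
Proof. exact: csmooth_section_on0. Qed.

Fact lsec_add_smooth (u v : G) : lsmooth_on setT (fun x => u x + v x).
Proof. exact: csmooth_section_onD (lsec_smooth u) (lsec_smooth v). Qed.

Fact lsec_scale_smooth (F : A) (u : G) :
  lsmooth_on setT (fun x => ev x F *: u x).
Proof. exact: csmooth_section_onZ (smooth_ringP F) (lsec_smooth u). Qed.

Fact lsec_opp_smooth (u : G) : lsmooth_on setT (fun x => - u x).
Proof.
have := csmooth_section_onZ oT (csmooth_on_cst setT (-1)) (lsec_smooth u).
by congr csmooth_section_on; apply/functional_extensionality_dep => x;
  rewrite scaleN1r.
Qed.

Definition lsec_zero : G := LSec x0 lsec_zero_smooth.
Definition lsec_add u v : G := LSec x0 (lsec_add_smooth u v).
Definition lsec_opp u : G := LSec x0 (lsec_opp_smooth u).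
Definition lsec_scale F u : G := LSec x0 (lsec_scale_smooth F u).

HB.instance Definition _ := gen_eqMixin G.
HB.instance Definition _ := gen_choiceMixin G.

Fact lsec_addA : associative lsec_add.
Proof. by move=> u v w; apply: lsec_ext => x; exact: addrA. Qed.
Fact lsec_addC : commutative lsec_add.
Proof. by move=> u v; apply: lsec_ext => x; exact: addrC. Qed.
Fact lsec_add0 : left_id lsec_zero lsec_add.
Proof. by move=> u; apply: lsec_ext => x; exact: add0r. Qed.
Fact lsec_addN : left_inverse lsec_zero lsec_opp lsec_add.
Proof. by move=> u; apply: lsec_ext => x; exact: addNr. Qed.

HB.instance Definition _ :=
  GRing.isZmodule.Build G lsec_addA lsec_addC lsec_add0 lsec_addN.

Fact lsec_scaleA a b v : lsec_scale a (lsec_scale b v) = lsec_scale (a * b) v.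
Proof. by apply: lsec_ext => x; exact: scalerA. Qed.
Fact lsec_scale1 : left_id 1 lsec_scale.
Proof. by move=> u; apply: lsec_ext => x; exact: scale1r. Qed.
Fact lsec_scaleDr : right_distributive lsec_scale +%R.
Proof. by move=> a u v; apply: lsec_ext => x; exact: scalerDr. Qed.
Fact lsec_scaleDl v : {morph lsec_scale^~ v : a b / a + b}.
Proof. by move=> a b; apply: lsec_ext => x; exact: scalerDl. Qed.

HB.instance Definition _ := GRing.Zmodule_isLmodule.Build A G
  lsec_scaleA lsec_scale1 lsec_scaleDr lsec_scaleDl.

Lemma lsec_addE (u v : G) x : (u + v) x = u x + v x. Proof. by []. Qed.
Lemma lsec_scaleE (F : A) (u : G) x : (F *: u) x = ev x F *: u x.
Proof. by []. Qed.

Lemma lsec_sumE (I : Type) (r : seq I) (u : I -> G) x :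
  (\sum_(i <- r) u i) x = \sum_(i <- r) u i x.
Proof. by elim/big_rec2: _ => // i y1 y2 _ <-. Qed.

Lemma lbracketE (u v : G) x : \val (lbracket u v x) =
  cbracket (fun y => \val (u y)) (fun y => \val (v y)) x.
Proof.
rewrite insubdK //; apply: gcs_involutive.
- exact: lsec_smooth.
- exact: lsec_smooth.
- by move=> y; exact: valP.
- by move=> y; exact: valP.
Qed.

Fact lsec_bracket_smooth (u v : G) : lsmooth_on setT (lbracket u v).
Proof.
have := cbracket_smooth (lsec_smooth u) (lsec_smooth v).
by congr csmooth_section_on; apply/functional_extensionality_dep => x;
  rewrite lbracketE.
Qed.

Definition lsec_bracket (u v : G) : G := LSec x0 (lsec_bracket_smooth u v).

Definition lsec_anchor (u : G) (F : A) : A :=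
  mk_smooth x0 (cder_smooth (lsec_smooth u) (smooth_ringP F)).

Lemma lsec_bracketDl u v w :
  lsec_bracket (u + v) w = lsec_bracket u w + lsec_bracket v w.
Proof.
apply: lsec_ext => x; apply: val_inj; rewrite lbracketE.
apply: etrans (cbracketDl x (lsec_smooth u) (lsec_smooth v) (lsec_smooth w)) _.
by rewrite lsec_addE raddfD /= !lbracketE.
Qed.

Lemma lsec_bracket_leibniz u (F : A) v w :
  lsec_bracket u (F *: v + w) =
  F *: lsec_bracket u v + lsec_anchor u F *: v + lsec_bracket u w.
Proof.
apply: lsec_ext => x; apply: val_inj; rewrite lbracketE.
apply: etrans (cbracket_leibniz x (smooth_ringP F) (lsec_smooth u)
  (lsec_smooth v) (lsec_smooth w)) _.
by rewrite !lsec_addE !raddfD /= !lbracketE.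
Qed.

Lemma lsec_bracket_self u : lsec_bracket u u = 0.
Proof.
apply: lsec_ext => x; apply: val_inj => /=; rewrite lbracketE.
apply: cbracket_self; first exact: lsec_smooth.
by move=> y; have iso := @gcs_isotropic _ _ _ _ L y; apply: iso; exact: valP.
Qed.

Lemma lsec_anchor_linear (F : A) u v H :
  lsec_anchor (F *: u + v) H = F * lsec_anchor u H + lsec_anchor v H.
Proof. by apply: smooth_ring_ext => x; exact: cder_linear. Qed.

Lemma lsec_anchorD u F H :
  lsec_anchor u (F + H) = lsec_anchor u F + lsec_anchor u H.
Proof.
by apply: smooth_ring_ext => x; apply: cderD; exact: smooth_ringP.
Qed.

Lemma lsec_anchorM u F H :
  lsec_anchor u (F * H) = F * lsec_anchor u H + H * lsec_anchor u F.
Proof.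
by apply: smooth_ring_ext => x; apply: cderM; exact: smooth_ringP.
Qed.

End SmoothSectionsOfL.

(** * Tensoriality *)

Section ComplexPairing.
Variables (R : realType) (m : nat) (M : smoothManifold R m).
Variable E : courantAlgebroid M.
Local Notation cpairing := (@cpairing _ _ _ E _).

Lemma cpairing_linear x a (u v w : cplx (E x)) :
  cpairing (a *: u + v) w = a * cpairing u w + cpairing v w.
Proof.
by case: a => ? ?; apply: eq_cplx => /=; rewrite !pairingE; ring.
Qed.

Lemma cpairing_sym x (u v : cplx (E x)) : cpairing u v = cpairing v u.
Proof.
apply: eq_cplx => /=; first by rewrite (pairing_sym u.1) (pairing_sym u.2).
by rewrite addrC (pairing_sym u.1) (pairing_sym u.2).
Qed.

Lemma cpairing0l x (w : cplx (E x)) : cpairing 0 w = 0.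
Proof.
have := cpairing_linear 1 0 0 w; rewrite scaler0 addr0 mul1r => /eqP.
by rewrite -subr_eq subrr eq_sym => /eqP.
Qed.

Lemma cpairingZl x a (u w : cplx (E x)) :
  cpairing (a *: u) w = a * cpairing u w.
Proof. by rewrite -[a *: u]addr0 cpairing_linear cpairing0l addr0. Qed.

Lemma cpairing_suml x n (a : 'I_n -> R[i]) (u : 'I_n -> cplx (E x)) w :
  cpairing (\sum_(i < n) a i *: u i) w = \sum_(i < n) a i * cpairing (u i) w.
Proof.
elim/big_rec2: _ => [|i y1 y2 _ IH]; first exact: cpairing0l.
by rewrite cpairing_linear IH.
Qed.

Lemma cpairing_nondegenerate x (u : cplx (E x)) :
  (forall v, cpairing u v = 0) -> u = 0.
Proof.
move=> u0; have H w : pairing u.1 w = 0 /\ pairing u.2 w = 0.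
  have [] := u0 (w, 0); rewrite /= !(pairing_sym _ 0) !pairing0l subr0 add0r.
  by [].
rewrite [u]surjective_pairing; congr (_, _);
  by apply: pairing_nondegenerate => w; case: (H w).
Qed.

Lemma cconjK x (u : cplx (E x)) : cconj (cconj u) = u.
Proof. by case: u => ? ?; rewrite /cconj /= opprK. Qed.

Lemma cconjD x (u v : cplx (E x)) : cconj (u + v) = cconj u + cconj v.
Proof. by congr (_, _); rewrite /= opprD. Qed.

Lemma cconjZ x a (u : cplx (E x)) : cconj (a *: u) = a^*%C *: cconj u.
Proof.
by case: a => ? ?; congr (_, _); rewrite /= ?scalerN ?scaleNr ?opprK // opprD.
Qed.

Lemma cpairing_conj_suml x n (a : 'I_n -> R[i]) (u : 'I_n -> cplx (E x)) w :
  (forall i, cpairing w (cconj (u i)) = 0) ->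
  cpairing w (cconj (\sum_(i < n) a i *: u i)) = 0.
Proof.
move=> u0; elim/big_rec: _ => [|i y _ IH].
  by rewrite cpairing_sym -[RHS](cpairing0l w); congr Defs.cpairing;
    rewrite /cconj /= oppr0.
rewrite cconjD cconjZ cpairing_sym cpairing_linear !(cpairing_sym _ w) u0 IH.
by rewrite mulr0 addr0.
Qed.

Lemma csmooth_cpairing (s t : forall x, cplx (E x)) : csmooth_section s ->
  csmooth_section t -> csmooth_on setT (fun x => cpairing (s x) (t x)).
Proof.
move=> [s1 s2] [t1 t2]; have oT : open [set: M] by exact: openT.
by split; [apply: smooth_onB|apply: smooth_onD] => //; exact: pairing_smooth.
Qed.

Lemma csmooth_cconj (s : forall x, cplx (E x)) : csmooth_section s ->
  csmooth_section (fun x => cconj (s x)).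
Proof.
move=> [s1 s2]; have oT : open [set: M] by exact: openT.
split=> //; have := smooth_section_onZ oT (smooth_on_cst setT (-1)) s2.
by congr smooth_section_on; apply/functional_extensionality_dep => x;
  rewrite scaleN1r.
Qed.

End ComplexPairing.

(** * Frames of L and dependence on values at a point *)

Section LocalFrames.
Variables (R : realType) (m : nat) (M : smoothManifold R m).
Variables (E : courantAlgebroid M) (L : generalizedComplex E) (x : M).
Local Notation A := (smooth_ring x).
Local Notation G := (lsec L x).

Lemma lsec_frame : exists (chi : M -> R) (r : nat)
    (l : 'I_r -> forall y, subspace (L y)) (s : 'I_r -> G),
  [/\ smooth chi, chi x = 1, is_basis (fun i => l i x),
      forall i y, s i y = (chi y)%:C *: l i y &
      forall y, chi y != 0 -> is_basis (fun i => l i y)].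
Proof.
have [U [r [l [oU Ux sl bl]]]] := gcs_subbundle L x.
have [chi [schi chix chiU]] := bump_exists oU Ux.
have ss i : lsmooth_on setT (fun y => (chi y)%:C *: l i y).
  exact: csmooth_section_supported chiU (sl i).
exists chi, r, l, (fun i => LSec x (ss i)); split=> // [|y chiy].
  exact: bl.
apply: bl; apply: contrapT => /(supported_in_eq0 chiU) /eqP.
by rewrite (negbTE chiy).
Qed.

Lemma lsec_through (v : subspace (L x)) : exists u : G, u x = v.
Proof.
have [chi [r [l [s [schi chix bx sE _]]]]] := lsec_frame.
have [a [va _]] := bx v.
exists (\sum_(i < r) mk_smooth x (csmooth_on_cst setT (a i)) *: s i).
rewrite lsec_sumE va; apply: eq_bigr => i _.
by rewrite lsec_scaleE sE chix scale1r.
Qed.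

(** A vector of the left kernel gives an element [w] of L orthogonal to the conjugate of L. By
    isotropy [w] is orthogonal to L as well, hence to the whole of [E_C], so [w = 0]. *)
Lemma gram_unit r (l : 'I_r -> subspace (L x)) : is_basis l ->
  \det (\matrix_(i, j) cpairing (\val (l i)) (cconj (\val (l j)))) != 0.
Proof.
move=> bl; apply/negP => /det0P[v v0 vG].
pose w := \sum_(i < r) v 0 i *: l i.
have wE : \val w = \sum_(i < r) v 0 i *: \val (l i).
  by rewrite /w raddf_sum; apply: eq_bigr => i _.
have wl j : cpairing (\val w) (cconj (\val (l j))) = 0.
  rewrite wE cpairing_suml.
  have := congr1 (fun N : 'rV__ => N 0 j) vG; rewrite !mxE => vGj.
  by rewrite -[RHS]vGj; apply: eq_bigr => i _; rewrite mxE.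
have w0 : \val w = 0.
  apply: cpairing_nondegenerate => e.
  have [[p1 p2] [[/= p1L p2L ->] _]] := gcs_decomposition L e.
  rewrite cpairing_sym -[p1]scale1r cpairing_linear mul1r.
  have iso := @gcs_isotropic _ _ _ _ L x.
  rewrite (iso _ _ p1L (valP w)) add0r cpairing_sym -[p2]cconjK.
  have [b [bE _]] := bl (exist _ (cconj p2) p2L).
  have -> : cconj p2 = \sum_(i < r) b i *: \val (l i).
    by rewrite -[LHS]/(\val (exist _ (cconj p2) p2L : subspace (L x))) bE
      raddf_sum.
  exact: cpairing_conj_suml.
have [b [_ bU]] := bl 0.
have b0 : b = fun=> 0 by apply: bU; rewrite big1 // => i _; rewrite scale0r.
have bv : b = v 0 by apply: bU; apply: val_inj; rewrite -/w w0.
case/negP: v0; apply/eqP/rowP => i; rewrite mxE.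
by rewrite -bv b0.
Qed.

(* The adjugate of the Gram matrix of a frame against its conjugate expresses a
   multiple of a section as a combination of the frame, without dividing. *)
Lemma lsec_tensorial (K : G -> A) (u : G) :
  (forall F v w, K (F *: v + w) = F * K v + K w) ->
  u x = 0 -> ev x (K u) = 0.
Proof.
move=> Klin ux; have [chi [r [l [s [schi chix bx sE bly]]]]] := lsec_frame.
have KD v w : K (v + w) = K v + K w.
  by rewrite -[v]scale1r Klin mul1r scale1r.
have K0 : K 0 = 0.
  have := KD 0 0; rewrite addr0 => /eqP.
  by rewrite -subr_eq subrr eq_sym => /eqP.
have KZ F v : K (F *: v) = F * K v by rewrite -[F *: v]addr0 Klin K0 addr0.
have cs (v : G) := lsec_smooth v.
pose gram : 'M[A]_r := \matrix_(i, j) mk_smooth x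
  (csmooth_cpairing (cs (s i)) (csmooth_cconj (cs (s j)))).
pose p : 'rV[A]_r := \row_j mk_smooth x
  (csmooth_cpairing (cs u) (csmooth_cconj (cs (s j)))).
pose X : A := mk_smooth x (csmooth_real schi).
have adjE y : map_mx (ev y) (p *m \adj gram) =
    map_mx (ev y) p *m \adj (map_mx (ev y) gram).
  by rewrite map_mxM map_mx_adj.
(* Cramer's rule where [chi] is nonzero. The factor [X] makes both sides 0 at the other points,
   where the [l i] need not form a basis. *)
have uE : (X * \det gram) *: u = \sum_(j < r) (X * (p *m \adj gram) 0 j) *: s j.
  apply: lsec_ext => y; rewrite lsec_sumE.
  have [chiy|chiy] := eqVneq (chi y) 0.
    have X0 : ev y X = 0 by rewrite /ev /= chiy.
    rewrite lsec_scaleE rmorphM /= X0 mul0r scale0r big1 // => j _.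
    by apply: etrans (lsec_scaleE _ _ _) _; rewrite rmorphM /= X0 mul0r scale0r.
  have [b [ub _]] := bly y chiy (u y).
  have cy : (chi y)%:C != 0 by rewrite eq_complex /= negb_and chiy.
  (* The coefficients of [u y] in the rescaled frame [s i y = chi y *: l i y]. *)
  pose b' := \row_i (b i / (chi y)%:C).
  have pE : map_mx (ev y) p = b' *m map_mx (ev y) gram.
    have vE : \val (u y) = \sum_(i < r) b i *: \val (l i y).
      by rewrite ub raddf_sum.
    apply/rowP => j; rewrite !mxE.
    transitivity (cpairing (\val (u y)) (cconj (\val (s j y)))); first by [].
    rewrite vE cpairing_suml.
    apply: eq_bigr => i _; rewrite !mxE.
    rewrite -[ev y _]/(cpairing (\val (s i y)) (cconj (\val (s j y)))).
    have -> : \val (s i y) = (chi y)%:C *: \val (l i y) by rewrite sE.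
    rewrite cpairingZl.
    by rewrite mulrA divfK.
  have qE j : ev y ((p *m \adj gram) 0 j) = ev y (\det gram) * b' 0 j.
    have -> : ev y ((p *m \adj gram) 0 j) = map_mx (ev y) (p *m \adj gram) 0 j.
      by rewrite [RHS]mxE.
    by rewrite adjE pE -mulmxA mul_mx_adj det_map_mx mul_mx_scalar !mxE.
  rewrite lsec_scaleE rmorphM /= ub scaler_sumr; apply: eq_bigr => j _.
  symmetry; apply: etrans (lsec_scaleE _ _ _) _.
  rewrite rmorphM /= qE mxE sE !scalerA; congr (_ *: _).
  by rewrite -!mulrA mulVf // mulr1.
(* At [x] the row [p] vanishes together with [u], whereas [X * \det gram] is nonzero by [gram_unit]
   and can be cancelled. *)
have : ev x (K ((X * \det gram) *: u)) = 0.
  have Ksum (I : Type) (t : seq I) (f : I -> A) (v : I -> G) :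
      K (\sum_(i <- t) f i *: v i) = \sum_(i <- t) f i * K (v i).
    by elim/big_rec2: _ => // i y1 y2 _ <-; rewrite Klin.
  rewrite uE Ksum rmorph_sum big1 // => j _.
  rewrite !rmorphM /=.
  have -> : ev x ((p *m \adj gram) 0 j) = map_mx (ev x) (p *m \adj gram) 0 j.
    by rewrite [RHS]mxE.
  rewrite adjE; have -> : map_mx (ev x) p = 0.
    by apply/rowP => i; rewrite !mxE /ev /= ux cpairing0l.
  by rewrite mul0mx mxE mulr0 mul0r.
rewrite KZ !rmorphM /= => /eqP; rewrite !mulf_eq0 /=.
have -> : ev x X = 1 by rewrite /ev /= chix.
rewrite oner_eq0 /= -det_map_mx.
have -> : map_mx (ev x) gram =
    \matrix_(i, j) cpairing (\val (l i x)) (cconj (\val (l j x))).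
  by apply/matrixP => i j; rewrite !mxE /ev /= !sE chix !scale1r.
by rewrite (negbTE (gram_unit bx)) => /eqP.
Qed.

Variable k : nat.

Lemma alt_form_local (P : alt_form G k) (u v : 'I_k -> G) :
  (forall i, u i x = v i x) -> ev x (alt_eval P u) = ev x (alt_eval P v).
Proof.
(* The arguments are exchanged one at a time; each exchange changes a single slot by a section that
   vanishes at [x]. *)
move=> uv; pose h n (i : 'I_k) := if (i < n)%N then v i else u i.
have -> : v = h k by apply/funext => i; rewrite /h ltn_ord.
have hn n : (n <= k)%N -> ev x (alt_eval P u) = ev x (alt_eval P (h n)).
  elim: n => [_|n IH nk]; first by congr (ev x (alt_eval P _)); apply/funext.
  rewrite IH ?(ltnW nk) //; pose i0 := Ordinal nk.
  have h1 : h n.+1 = upd (h n) i0 (v i0).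
    apply/funext => i; rewrite /h /upd -val_eqE /= ltnS leq_eqVlt.
    by case: eqP => //= e; congr v; apply: val_inj.
  have h0 : h n = upd (h n) i0 (u i0).
    apply/funext => i; rewrite /upd -val_eqE /=; case: eqP => // e.
    by rewrite /h e ltnn; congr u; apply: val_inj.
  rewrite {1}h0 h1; apply/eqP; rewrite -subr_eq0 -rmorphB /=; apply/eqP.
  have ml := @alt_form_multilinear _ _ _ P.
  rewrite -(multilinearN ml) -(multilinearD ml).
  apply: (@lsec_tensorial (fun w => alt_eval P (upd (h n) i0 w))).
    by move=> F w w'; rewrite (multilinearP ml).
  by rewrite lsec_addE uv; exact: subrr.
exact: hn.
Qed.

(** The sections through given values are chosen without any linearity in the value;
    [alt_form_local] makes the resulting function multilinear all the same. *)
Lemma alt_form_at (P : alt_form G k) : exists psi : alt_form (subspace (L x)) k,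
  forall u : 'I_k -> G, alt_eval psi (fun i => u i x) = ev x (alt_eval P u).
Proof.
have [sec secE] := choice lsec_through.
have ml := @alt_form_multilinear _ _ _ P.
pose f (v : 'I_k -> subspace (L x)) := ev x (alt_eval P (sec \o v)).
have mf : multilinear f.
  move=> i v a y z; rewrite !updE.
  have cv w : sec \o upd v i w = upd (sec \o v) i (sec w).
    by apply/funext => j; rewrite /upd /=; case: eqP.
  pose F := mk_smooth x (csmooth_on_cst setT a).
  rewrite /f !cv -[a]/(ev x F) -rmorphM -rmorphD -(multilinearP ml).
  apply: alt_form_local => j; rewrite /upd; case: eqP => // _.
  by rewrite lsec_addE lsec_scaleE !secE.
have af : alternating f.
  move=> v i j ij vij; rewrite /f (@alt_form_alternating _ _ _ P _ i j) ?rmorph0 //.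
  by rewrite /= vij.
exists (mk_alt mf af) => u; apply: alt_form_local => i.
exact: secE.
Qed.

End LocalFrames.

(** * The principal symbol *)

Section LieAlgebroidSymbol.
Variables (R : realType) (m : nat) (M : smoothManifold R m).
Variables (E : courantAlgebroid M) (L : generalizedComplex E) (x : M).
Local Notation A := (smooth_ring x).
Local Notation G := (lsec L x).

Lemma lsection_lsec k (u : 'I_k -> lsection L) :
  (forall i, lsmooth_on setT (u i)) ->
  exists v : 'I_k -> G, u = fun i y => v i y.
Proof. by move=> su; exists (fun i => LSec x (su i)). Qed.

Section Global.
Variables (k : nat) (phi : forall y, lform L k y) (sphi : smooth_lform phi).

Definition global_form_fun (u : 'I_k -> G) : A := mk_smooth x
  (sphi openT (fun i => lsec_smooth (u i))).

Fact global_form_multilinear : multilinear global_form_fun.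
Proof.
move=> i v F u w; rewrite !updE; apply: smooth_ring_ext => y.
have updy (z : G) : (fun j => upd v i z j y) = upd (fun j => v j y) i (z y).
  by apply/funext => j; rewrite /upd; case: eqP.
have gE z : ev y (global_form_fun z) = lform_eval (phi y) (fun j => z j y).
  by [].
rewrite rmorphD rmorphM /= !gE !updy.
rewrite /lform_eval lsec_addE lsec_scaleE.
by rewrite (multilinearP (@alt_form_multilinear _ _ _ (phi y))).
Qed.

Fact global_form_alternating : alternating global_form_fun.
Proof.
move=> v i j ij vij; apply: smooth_ring_ext => y.
apply: (@alt_form_alternating _ _ _ (phi y) _ i j ij).
by rewrite vij.
Qed.

Definition global_form : alt_form G k :=
  mk_alt global_form_multilinear global_form_alternating.

Lemma global_formE (u : 'I_k -> G) y :
  ev y (alt_eval global_form u) = lform_eval (phi y) (fun i => u i y).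
Proof. by []. Qed.

End Global.

Definition dG k (p : alt_form G k) : alt_form G k.+1 :=
  ce_diff (@lsec_bracketDl _ _ _ _ L x) (@lsec_bracket_leibniz _ _ _ _ L x)
    (@lsec_bracket_self _ _ _ _ L x) (@lsec_anchor_linear _ _ _ _ L x)
    (@lsec_anchorD _ _ _ _ L x) (@lsec_anchorM _ _ _ _ L x) p.

Lemma dG_koszul k (phi : forall y, lform L k y) (sphi : smooth_lform phi)
    (u : 'I_k.+1 -> G) y :
  ev y (alt_eval (dG (global_form sphi)) u) = koszul phi (fun i y => u i y) y.
Proof.
rewrite -[alt_eval _ u]/(ce_fun (@lsec_bracket _ _ _ _ L x)
  (@lsec_anchor _ _ _ _ L x) (global_form sphi) u).
rewrite /ce_fun /koszul rmorphD; congr (_ + _).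
  rewrite /ce_anchor /koszul_anchor rmorph_sum; apply: eq_bigr => i _.
  by rewrite rmorphM rmorphXn rmorphN1.
case: k phi sphi u => [|k] phi sphi u; first exact: rmorph0.
rewrite /ce_bracket /koszul_bracket rmorph_sum; apply: eq_bigr => i _.
rewrite rmorph_sum; apply: eq_bigr => j _.
rewrite rmorphM rmorphXn rmorphN1; congr (_ * _).
apply: etrans (global_formE sphi _ y) _.
congr (lform_eval (phi y) _); apply/funext => q.
by rewrite /fcons /cons_sections; case: (unlift ord0 q).
Qed.

Lemma dL_koszul k (phi : forall y, lform L k y) (sphi : smooth_lform phi)
    (u : 'I_k.+1 -> G) :
  lform_eval (dL phi x) (fun i => u i x) =
  ev x (alt_eval (dG (global_form sphi)) u).
Proof.
have dLP : [set psi : lform L k.+1 x | forall u : 'I_k.+1 -> lsection L,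
    (forall i, lsmooth_on setT (u i)) ->
    lform_eval psi (fun i => u i x) = koszul phi u x] (dL phi x).
  (* The set that defines [dL] is inhabited, so [xget] does not return its default 0. *)
  apply: xgetPex; have [psi psiE] := alt_form_at (dG (global_form sphi)).
  exists psi => w /lsection_lsec[v ->].
  by rewrite -[LHS]/(alt_eval psi (fun i => v i x)) psiE dG_koszul.
rewrite dG_koszul.
exact: (dLP (fun i y => u i y) (fun i => lsec_smooth (u i))).
Qed.

Definition cplx_covector (alpha : covector x) (w : cplx (E x)) : R[i] :=
  alpha (anchor E x w.1) +i* alpha (anchor E x w.2).

Lemma cplx_covector_linear alpha a u v :
  cplx_covector alpha (a *: u + v) =
  a * cplx_covector alpha u + cplx_covector alpha v.
Proof.
case: a => a b; rewrite /cplx_covector /=.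
rewrite !(linearD (anchor E x)) !(linearN (anchor E x)) !(linearZ_LR (anchor E x)).
rewrite !(linearD alpha) !(linearN alpha) !(linearZ_LR alpha).
by rewrite -![_ *: alpha _]/(_ * _); apply: eq_cplx => /=; ring.
Qed.

Definition symbol_form (alpha : covector x) (l : subspace (L x)) : R[i] :=
  cplx_covector alpha (\val l).

Lemma symbol_form_linear alpha a u v :
  symbol_form alpha (a *: u + v) = a * symbol_form alpha u + symbol_form alpha v.
Proof. exact: cplx_covector_linear. Qed.

(* A real covector that vanishes on L also vanishes on its conjugate. *)
Lemma symbol_form_neq0 (alpha : covector x) :
  transitive_ca E -> ~ (forall X, alpha X = 0) -> exists e, symbol_form alpha e = 1.
Proof.
move=> tE alpha0; suff [l l0] : exists l, symbol_form alpha l != 0.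
  exists ((symbol_form alpha l)^-1 *: l).
  by rewrite (GRing.scalable_linear (symbol_form_linear alpha)); exact: mulVf.
apply: contrapT => nl; apply: alpha0 => X; have [u <-] := tE x X.
have L0 w : w \in L x -> cplx_covector alpha w = 0.
  move=> Lw; apply/eqP/negP => /negP w0; apply: nl.
  by exists (exist _ w Lw).
have [[p1 p2] [[/= p1L p2L up] _]] := gcs_decomposition L (u, 0 : E x).
have p20 : cplx_covector alpha p2 = 0.
  have /(congr1 (fun z => (complex.Re z, complex.Im z))) /= [H1 H2] := L0 _ p2L.
  rewrite /cplx_covector H1; congr (_ +i* _); move: H2.
  by rewrite (linearN (anchor E x)) (linearN alpha) => /eqP;
    rewrite oppr_eq0 => /eqP.
have : cplx_covector alpha (u, 0) = 0.
  by rewrite up -[p1]scale1r cplx_covector_linear (L0 _ p1L) p20 mulr0 addr0.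
by move/(congr1 (@complex.Re R)).
Qed.

Definition symbol k (alpha : covector x) : {linear lform L k x -> lform L k.+1 x} :=
  @wedge _ _ (symbol_form alpha) (symbol_form_linear alpha) k.

Lemma dL_symbol k (f : M -> R) (s : forall y, lform L k y) :
  smooth f -> smooth_lform s ->
  dL (fun y => (f y)%:C *: s y) x - (f x)%:C *: dL s x =
  symbol k (differential f : covector x) (s x).
Proof.
move=> sf ss; pose F : A := mk_smooth x (csmooth_real sf).
have sfs : smooth_lform (fun y => (f y)%:C *: s y).
  move=> U u oU su; apply: csmooth_onM => //; last exact: ss.
  by apply: csmooth_real; exact: (smooth_on_sub (@subsetT _ U) sf).
(* The summand 0 gives the shape that [ce_funZD] expects. *)
have gE : global_form sfs = F *: global_form ss + 0.
  by apply: alt_form_ext => u; apply: smooth_ring_ext => y; rewrite addr0.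
apply: alt_form_ext => v.
have [sec secE] := choice (@lsec_through _ _ _ _ L x).
(* The values of [dL] are known on tuples that come from smooth sections, so each vector is extended
   to one. *)
pose u i := sec (v i); have -> : v = fun i => u i x.
  by apply/funext => i; rewrite /u secE.
transitivity (lform_eval (dL (fun y => (f y)%:C *: s y) x) (fun i => u i x) -
  (f x)%:C * lform_eval (dL s x) (fun i => u i x)); first by [].
rewrite (dL_koszul sfs) (dL_koszul ss) gE.
have -> : alt_eval (dG (F *: global_form ss + 0)) u =
    F * alt_eval (dG (global_form ss)) u +
    wedge_fun ((@lsec_anchor _ _ _ _ L x)^~ F) (alt_eval (global_form ss)) u.
  have := @ce_funZD _ _ (@lsec_bracket _ _ _ _ L x) (@lsec_anchor _ _ _ _ L x)
    (@lsec_anchorD _ _ _ _ L x) (@lsec_anchorM _ _ _ _ L x) k F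
    (global_form ss) 0 u.
  by rewrite (ce_fun_zero _ (@lsec_anchorD _ _ _ _ L x)) (addr0 (F * _)).
rewrite rmorphD rmorphM addrAC subrr add0r.
rewrite /wedge_fun rmorph_sum; apply: eq_bigr => i _.
rewrite !rmorphM rmorphXn rmorphN1 /=; congr (_ * (_ * _)).
exact: cder_real.
Qed.

End LieAlgebroidSymbol.

Theorem proposition2p25 (R : realType) (m : nat) (M : smoothManifold R m)
    (E : courantAlgebroid M) (L : generalizedComplex E) :
  transitive_ca E -> elliptic_complex (@smooth_lform R m M E L) (@dL R m M E L).
Proof.
move=> tE; exists (fun k x => @symbol R m M E L x k); split.
  by move=> k f s sf ss x; exact: dL_symbol.
move=> x alpha alpha0; have [e e1] := symbol_form_neq0 L tE alpha0.
split; first exact: (@wedge_inj0 _ _ _ (symbol_form_linear alpha) _ e1).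
by move=> k; exact: (@wedge_exact _ _ _ (symbol_form_linear alpha) _ e1).
Qed.
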